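(* Let $p,q\in\mathbb{N}$ with $\gcd(p,q)=1$, set $\alpha=2\pi p/q$ and $\lambda=e^{i\alpha}$, and let $\mathcal{U}$ be the regular set of $F_\lambda$. Then every connected component of $\mathcal{U}$ is open, bounded and periodic under the action of $F_\lambda$. More precisely, for each connected component $V$ of $\mathcal{U}$ there are positive integers $\ell=\ell(V)$ and $k=k(V)$, both depending on $V$, such that $F_\lambda$ permutes the $\ell$ connected components $V,F_\lambda(V),\dots,F_\lambda^{\ell-1}(V)$ of $\mathcal{U}$, each of these components is invariant by $F_\lambda^{\ell}$, and $F_\lambda^{\ell}$ restricted to each of them is a rotation of order $k$ around a point (the center) of that component. As a consequence, on each connected component the center is an $\ell$-periodic point of $F_\lambda$ and the rest of the points are $k\ell$-periodic. Moreover, $\ell$ is unbounded, i.e. $\sup_V \ell(V)=\infty$, where $V$ ranges over the connected components of $\mathcal{U}$.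
   Context: For $\lambda\in\mathbb{C}$ with $|\lambda|=1$, the map $F_\lambda:\mathbb{C}\to\mathbb{C}$ is $F_\lambda(z)=\lambda(z-H(z))$, where $H(z)=1$ if $\mathrm{Im}(z)\ge 0$ and $H(z)=-1$ if $\mathrm{Im}(z)<0$. It is a bijection. The critical set is $\mathcal{F}=\{z\in\mathbb{C} : \mathrm{Im}(F_\lambda^i(z))=0 \text{ for some } i\in\mathbb{N}\cup\{0\}\}$, and the regular set is $\mathcal{U}=\mathbb{C}\setminus\overline{\mathcal{F}}$, where $\overline{\mathcal{F}}$ is the closure of $\mathcal{F}$. Here $\mathbb{N}=\{1,2,\dots\}$. A connected component $V$ of $\mathcal{U}$ is periodic of period $\ell$ if $F_\lambda^\ell(V)=V$ and $\ell\ge1$ is minimal with this property. A point $z$ is $n$-periodic if $F_\lambda^n(z)=z$ and $n\geq 1$ is minimal with this property. A rotation of order $k$ is a rotation $R$ of the plane with $R^k=\mathrm{Id}$ and $k\ge1$ minimal; the case $k=1$ is the identity.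
   Formalization: The statement is proved for q > 2; for q = 1 or 2 (λ = 1 or −1) it is false, since |Im z| is preserved, the critical set is the real axis, and the components of the regular set are the two unbounded open half-planes. *)

(* Defs.v *)
From mathcomp Require Import all_boot all_order all_algebra.
From mathcomp Require Import all_classical all_reals all_analysis.
From mathcomp.real_closed Require Import complex.

Set Implicit Arguments.
Unset Strict Implicit.
Unset Printing Implicit Defensive.

Import Order.TTheory GRing.Theory Num.Theory.
Import numFieldNormedType.Exports.

Local Open Scope classical_set_scope.
Local Open Scope ring_scope.

(* MathComp-Analysis attaches the metric topology and the norm to types that
   are syntactically the carrier of a numFieldType, which R[i] is not; hence
   this packaging. *)
Definition Cplx (R : realType) : numClosedFieldType := R[i].

Definition expi (R : realType) (a : R) : Cplx R := Complex (cos a) (sin a).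

Definition Hsgn (R : realType) (z : Cplx R) : Cplx R :=
  if 0 <= complex.Im z then 1 else -1.

Definition Fmap (R : realType) (lam z : Cplx R) : Cplx R := lam * (z - Hsgn z).

Definition critical_set (R : realType) (lam : Cplx R) : set (Cplx R) :=
  [set z | exists i : nat, complex.Im (iter i (Fmap lam) z) = 0].

Definition regular_set (R : realType) (lam : Cplx R) : set (Cplx R) :=
  ~` closure (critical_set lam).

Definition is_component (T : topologicalType) (A V : set T) : Prop :=
  exists2 x, A x & V = connected_component A x.

Definition least_positive (P : nat -> Prop) (n : nat) : Prop :=
  [/\ (0 < n)%N, P n & forall m, (0 < m)%N -> P m -> (n <= m)%N].

Definition set_period (T : Type) (f : T -> T) (V : set T) (l : nat) : Prop :=
  least_positive (fun n => iter n f @` V = V) l.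

Definition point_period (T : Type) (f : T -> T) (z : T) (n : nat) : Prop :=
  least_positive (fun m => iter m f z = z) n.

Definition rotation_about (R : realType) (c : Cplx R) (r : Cplx R -> Cplx R)
    : Prop :=
  exists2 w : Cplx R, `|w| = 1 & forall z, r z = c + w * (z - c).

(* The identity has order 1, and is a rotation about every point. *)
Definition map_order (T : Type) (r : T -> T) (k : nat) : Prop :=
  least_positive (fun m => iter m r =1 id) k.

(* Main.v *)
(** Multiplication by lambda permutes the vertices v_j of a regular 2M-gon with
    unit edges, two of them horizontal, where M = q or q/2.  For every m there
    is a necklace of translates of this polygon, neighbours sharing a vertex:
    the centres run along a convex polygon whose j-th side consists of m or
    m + 1 steps 2 v_j.  Translating the upper half by -1 and the lower half by 1
    moves one step from the side v_0 to the side v_1 = v_0 - 1, and likewise for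
    the opposite sides; the run lengths are chosen so that this equals a
    rotation by 1/lambda.  Hence F permutes the tiles of the necklace and, off
    the real axis, maps the region they enclose into itself.  So orbits of
    regular points are bounded, and the centres of the tiles are regular points
    arbitrarily far away.

    A component of U consists of the regular points with a given itinerary; it
    is convex, and F^n acts on it as an affine map with linear part lambda^n.
    By boundedness and pigeonhole a ball in the component returns to meet
    itself, and a return map that is a translation is trivial because its orbits
    are bounded.  The average over a return cycle is the center.  If F^L y = y
    and lambda^L = 1, summing the displacements gives |Im F^n y| <= L^2 for
    n < L, so components are bounded, and bounded periods would make U bounded. *)

Require Import Defs.
From mathcomp Require Import all_boot all_order all_algebra.
From mathcomp Require Import all_classical all_reals all_analysis.
From mathcomp.real_closed Require Import complex.
From mathcomp Require Import zify ring lra.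

Set Implicit Arguments.
Unset Strict Implicit.
Unset Printing Implicit Defensive.

Import Order.TTheory GRing.Theory Num.Theory.
Import numFieldNormedType.Exports.

Local Open Scope classical_set_scope.
Local Open Scope ring_scope.

(** * Periodic indices and single-term sums *)

(** The window is [1..M] because the sides [v_1, ..., v_M] are those of the upper half of the
    necklace; central symmetry supplies the rest. *)
Lemma nat_period_ind (M : nat) (Q : nat -> Prop) : (0 < M)%N ->
  (forall j, (0 < j <= M)%N -> Q j) -> (forall j, Q j <-> Q (j + M)%N) ->
  forall j, Q j.
Proof.
move=> M0 h per.
have iterM k j : Q j <-> Q (j + k * M)%N.
  elim: k => [|k IH]; first by rewrite mul0n addn0.
  by rewrite mulSn [(M + _)%N]addnC addnA -per.
move=> [|j]; first by apply/per; apply: h; rewrite add0n M0 leqnn.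
rewrite (divn_eq j M) addnC -addSn; apply: (iterM _ _).1; apply: h.
by rewrite /= ltn_mod.
Qed.

(** Lets an isolated correction term be absorbed into a sum over a window of length [M]. *)
Lemma sum_pick (R : pzRingType) (M j k : nat) (g : nat -> R) :
  (j <= k < j + M)%N -> \sum_(i < M) (j + i == k)%N%:R * g (j + i)%N = g k.
Proof.
move=> /andP[jk kM].
have kjM : (k - j < M)%N by lia.
rewrite (bigD1 (Ordinal kjM)) //= subnKC // eqxx mul1r big1 ?addr0 //.
move=> i /eqP ik; case: eqP => [e|_]; last by rewrite mul0r.
by case: ik; apply: val_inj => /=; lia.
Qed.

(** * Regular polygons *)

Section Polygon.
Variables (R : realType) (M : nat).
Hypothesis M2 : (1 < M)%N.

(** Half the central angle of an edge. The vertex [v_j] is [i e^(i vangle j) / (2 sin theta)]: this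
    circumradius gives unit edges, and the offset in [vangle] makes the edge from [v_0] to [v_1] the
    horizontal top one. *)
Definition theta : R := pi / (2 * M%:R).
Definition vangle (j : nat) : R := (2 * j%:R - 1) * theta.
Definition vx j : R := - sin (vangle j) / (2 * sin theta).
Definition vy j : R := cos (vangle j) / (2 * sin theta).
Definition apothem : R := cos theta / (2 * sin theta).

Let M0 : 0 < M%:R :> R. Proof. by rewrite ltr0n ltnW. Qed.

Lemma thetaM : 2 * M%:R * theta = pi.
Proof. by rewrite /theta; field; rewrite gt_eqF. Qed.

Lemma theta_gt0 : 0 < theta.
Proof. by rewrite divr_gt0 ?pi_gt0 // mulr_gt0. Qed.

Lemma theta_lt : theta < pi / 2.
Proof.
have := thetaM; have : (2%:R : R) <= M%:R by rewrite ler_nat.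
have := theta_gt0; nra.
Qed.

Lemma sin_theta_gt0 : 0 < sin theta.
Proof.
apply: sin_gt0_pi; rewrite theta_gt0 /=.
by have := theta_lt; have := pi_gt0 R; lra.
Qed.

Lemma cos_theta_gt0 : 0 < cos theta.
Proof. by apply: cos_gt0_pihalf; have := theta_lt; have := theta_gt0; lra. Qed.

Let st := sin_theta_gt0.
Let st0 : sin theta != 0. Proof. by rewrite gt_eqF. Qed.

Lemma apothem_gt0 : 0 < apothem.
Proof. by rewrite divr_gt0 ?cos_theta_gt0 // mulr_gt0. Qed.

Lemma vangleD j i : vangle (j + i) = vangle j + 2 * i%:R * theta.
Proof. by rewrite /vangle natrD; ring. Qed.

Lemma vangleM j : vangle (j + M) = vangle j + pi.
Proof. by rewrite vangleD thetaM. Qed.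

Lemma vxM j : vx (j + M) = - vx j.
Proof. by rewrite /vx vangleM sinDpi; ring. Qed.

Lemma vyM j : vy (j + M) = - vy j.
Proof. by rewrite /vy vangleM cosDpi; ring. Qed.

Lemma vx0 : vx 0 = 1 / 2.
Proof.
rewrite /vx /vangle mulr0 sub0r mulN1r sinN; field.
by rewrite st0.
Qed.

Lemma vy0 : vy 0 = apothem.
Proof. by rewrite /vy /vangle mulr0 sub0r mulN1r cosN. Qed.

Lemma vx1 : vx 1 = - (1 / 2).
Proof.
by rewrite /vx /vangle (_ : 2 * 1 - 1 = 1 :> R) ?mul1r; [field|ring].
Qed.

Lemma vy1 : vy 1 = apothem.
Proof. by rewrite /vy /vangle (_ : 2 * 1 - 1 = 1 :> R) ?mul1r //; ring. Qed.

Lemma vx_rot s j : vx (j + s) =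
  cos (2 * s%:R * theta) * vx j - sin (2 * s%:R * theta) * vy j.
Proof. by rewrite /vx /vy vangleD sinD; ring. Qed.

Lemma vy_rot s j : vy (j + s) =
  sin (2 * s%:R * theta) * vx j + cos (2 * s%:R * theta) * vy j.
Proof. by rewrite /vx /vy vangleD cosD; ring. Qed.

Definition vcross j i : R := vx j * vy i - vy j * vx i.

Lemma vcrossE j d : vcross j (j + d) = sin (2 * d%:R * theta) / (4 * sin theta ^+ 2).
Proof.
rewrite /vcross vx_rot vy_rot.
transitivity (sin (2 * d%:R * theta) * (vx j ^+ 2 + vy j ^+ 2)); first by ring.
have -> : vx j ^+ 2 + vy j ^+ 2 = 1 / (4 * sin theta ^+ 2); last by field.
have := cos2Dsin2 (vangle j); rewrite /vx /vy => h.
by rewrite -[X in X / _]h; field.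
Qed.

Lemma vcross_ge0 j d : (d <= M)%N -> 0 <= vcross j (j + d).
Proof.
move=> dM; rewrite vcrossE divr_ge0 //; last by rewrite mulr_ge0 ?sqr_ge0.
apply: sin_ge0_pi; rewrite -thetaM.
have : (d%:R : R) <= M%:R by rewrite ler_nat.
have : 0 <= d%:R :> R by [].
by have := theta_gt0; move=> *; apply/andP; split; nra.
Qed.

Lemma vcrossS j : vcross j j.+1 = apothem.
Proof.
rewrite -addn1 vcrossE mulr1 mulr_natl mulr2n sinD /apothem; field.
by rewrite st0.
Qed.

Lemma vy_decr i j : (0 < i)%N -> (i <= j <= M)%N -> vy j <= vy i.
Proof.
move=> i0 /andP[ij jM]; rewrite /vy ler_pM2r ?invr_gt0 ?mulr_gt0 //.
have : 1 <= i%:R :> R by rewrite ler1n.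
have : i%:R <= j%:R :> R by rewrite ler_nat.
have : j%:R <= M%:R :> R by rewrite ler_nat.
move=> h1 h2 h3; have h4 := theta_gt0; have h5 := thetaM.
by rewrite leNgt ltr_cos -?leNgt ?in_itv /vangle /=; [nra|apply/andP; split; nra..].
Qed.

(** The vertices [k] and [M + 1 - k] are mirror images in the real axis. *)
Lemma vy_reflect k : (0 < k <= M)%N -> vy (M.+1 - k) = - vy k.
Proof.
move=> /andP[k0 kM]; rewrite /vy (_ : vangle _ = pi - vangle k).
  by rewrite cosB sinpi cospi; ring.
by rewrite /vangle -thetaM natrB ?leqW // -natr1; ring.
Qed.

Lemma vy_le j : `|vy j| <= apothem.
Proof.
move: j; apply: (@nat_period_ind M); first exact: ltnW.
  move=> j /andP[j0 jM]; rewrite ler_norml -vy1 vy_decr ?j0 // andbT.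
  by rewrite vy1 -vy0 -vyM add0n vy_decr ?jM /=.
by move=> j; rewrite vyM normrN.
Qed.

Lemma vx_bound j : `|vx j| <= (2 * sin theta)^-1.
Proof.
rewrite normrM normrN (ger0_norm (ltW (_ : 0 < (2 * sin theta)^-1))); last first.
  by rewrite invr_gt0 mulr_gt0.
by rewrite ler_piMl ?invr_ge0 ?mulr_ge0 // ?(ltW st) // ler_norml sin_geN1 sin_le1.
Qed.

Lemma vy_bound j : `|vy j| <= (2 * sin theta)^-1.
Proof.
rewrite normrM (ger0_norm (ltW (_ : 0 < (2 * sin theta)^-1))); last first.
  by rewrite invr_gt0 mulr_gt0.
by rewrite ler_piMl ?invr_ge0 ?mulr_ge0 // ?(ltW st) // ler_norml cos_geN1 cos_le1.
Qed.

(* The 2M-gon with vertices [v_j], as an intersection of strips. *)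
Definition tile (x y : R) : Prop :=
  forall i : nat, `|sin (2 * i%:R * theta) * x + cos (2 * i%:R * theta) * y| <= apothem.

Lemma tile_rot s x y : tile x y ->
  tile (cos (2 * s%:R * theta) * x - sin (2 * s%:R * theta) * y)
       (sin (2 * s%:R * theta) * x + cos (2 * s%:R * theta) * y).
Proof.
move=> h i; have := h (i + s)%N.
rewrite natrD mulrDr [(_ + _) * theta]mulrDl sinD cosD.
by congr (`|_| <= _); ring.
Qed.

(** The corners of the rectangle are [v_0], [v_1] and their opposites, and [vy_le] for the rotated
    vertices bounds each linear form there. *)
Lemma tile_rect x y : `|x| <= 1 / 2 -> `|y| <= apothem -> tile x y.
Proof.
move=> hx hy i.
set S := sin _; set C := cos _.
have h0 : `|S * (1 / 2) + C * apothem| <= apothem.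
  by have := vy_le (0 + i); rewrite vy_rot vx0 vy0.
have h1 : `|S * (- (1 / 2)) + C * apothem| <= apothem.
  by have := vy_le (1 + i); rewrite vy_rot vx1 vy1.
move: hx hy h0 h1; rewrite !ler_norml => /andP[a1 a2] /andP[a3 a4].
move=> /andP[a5 a6] /andP[a7 a8].
have := apothem_gt0 => a9.
have : `|S| * `|x| <= `|S| * (1 / 2) by rewrite ler_wpM2l // ler_norml a1 a2.
have : `|C| * `|y| <= `|C| * apothem by rewrite ler_wpM2l // ler_norml a3 a4.
rewrite -!normrM => hC hS.
have {}hC : - (`|C| * apothem) <= C * y <= `|C| * apothem by rewrite -ler_norml.
have {}hS : - (`|S| * (1/2)) <= S * x <= `|S| * (1/2) by rewrite -ler_norml.
move/andP: hC => [c1 c2]; move/andP: hS => [c3 c4].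
by case: (ger0P S) c3 c4 => ? ??; case: (ger0P C) c1 c2 => ? ??; apply/andP; split; lra.
Qed.

Lemma tile_y x y : tile x y -> `|y| <= apothem.
Proof. by move=> /(_ 0%N); rewrite mulr0 mul0r sin0 cos0 mul0r add0r mul1r. Qed.

Lemma tileN x y : tile x y -> tile (- x) (- y).
Proof. by move=> h i; rewrite !mulrN -opprD normrN. Qed.

End Polygon.

(** * Necklaces *)

Section Ring.
Variables (R : realType) (M s u m : nat).
Hypotheses (M2 : (1 < M)%N) (uM : (u < M)%N) (su : (u * s = 1 %[mod M])%N).

Local Notation vx := (@vx R M).
Local Notation vy := (@vy R M).
Local Notation a := (apothem R M).
Local Notation theta := (theta R M).
Local Notation alpha := (2 * s%:R * theta).

(* The number of tile steps on the side [v_j]: the solution of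
   [run (j + s) = run j + (j == 1) - (j == 0)] modulo [M]. *)
Definition run (j : nat) : nat :=
  if (0 < (u * j) %% M <= u)%N then m else m.+1.

Lemma u_gt0 : (0 < u)%N.
Proof.
case: u su => // /esym; rewrite mul0n mod0n modn_small //.
Qed.

(** As [u] inverts [s], shifting [j] by [s] advances the residue [t = u * j mod M] by one, and [run]
    is constant on two blocks of this cycle. *)
Lemma mod_mul_shift (j : nat) : (u * (j + s) %% M = ((u * j) %% M).+1 %% M)%N.
Proof. by rewrite mulnDr -modnDmr su modnDmr -[in RHS]addn1 modnDml. Qed.

Lemma runM j : run (j + M) = run j.
Proof. by rewrite /run mulnDr addnC modnMDl. Qed.

Lemma mod_u_eq (j k : nat) : ((u * j) %% M == (u * k) %% M)%N = (j == k %[mod M])%N.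
Proof.
apply/eqP/eqP => h; last by rewrite -modnMmr h modnMmr.
have e i : (i = s * (u * i) %[mod M])%N.
  by rewrite mulnA [(s * u)%N]mulnC -modnMml su modnMml mul1n.
by rewrite (e j) (e k) -modnMmr h modnMmr.
Qed.

(** Along the cycle of residues [t] the run length drops on leaving [t = 0], where [j = 0], and
    rises on leaving [t = u], where [j = 1]. *)
Lemma run_shift j : ((run (j + s))%:R : R) =
  (run j)%:R + (j == 1 %[mod M])%:R - (j == 0 %[mod M])%:R.
Proof.
have u0 := u_gt0.
rewrite /run mod_mul_shift -(mod_u_eq j 1) -(mod_u_eq j 0) muln0 muln1 mod0n (modn_small uM).
set t := ((u * j) %% M)%N; have tM : (t < M)%N by rewrite ltn_mod ltnW.
have [->|t0] := eqVneq t 0%N.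
  by rewrite (ltn_eqF u0) /= modn_small // u0 /= -natr1; ring.
have [->|tu] := eqVneq t u.
  rewrite u0 leqnn /= subr0.
  have [->|uM'] := eqVneq u.+1 M; first by rewrite modnn natr1.
  by rewrite modn_small ?ltnn /= ?natr1 //; lia.
rewrite addr0 subr0; congr (_%:R).
clearbody t; have [tM'|tM'] := eqVneq t.+1 M.
  by rewrite tM' modnn /=; case: ifP => //; lia.
rewrite modn_small; last by lia.
by congr (if _ then _ else _); lia.
Qed.

(** If [k] has residue [t], the two indices have residues [u - t] and [t + 1] modulo [M]; both lie
    in [1..u] exactly when [t < u]. *)
Lemma run_reflect k : (0 < k <= M)%N -> run (M.+1 - k) = run (k + s).
Proof.
move=> /andP[k0 kM]; rewrite /run mod_mul_shift.
have : (u * (M.+1 - k) + u * k = u %[mod M])%N.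
  by rewrite -mulnDr subnK ?leqW // mulnS addnC modnMDl.
rewrite -[(u * (M.+1 - k) + _)%N]addnC -modnDml -modnDmr.
set t := ((u * k) %% M)%N; set t' := ((u * (M.+1 - k)) %% M)%N.
have tM : (t < M)%N by rewrite ltn_mod ltnW.
have tM' : (t' < M)%N by rewrite ltn_mod ltnW.
rewrite (modn_small uM); clearbody t t' => e.
have [tM1|tM1] := eqVneq t.+1 M.
  rewrite tM1 modnn /= ; case: ifP => //.
  have [h|h] := ltnP (t + t') M; first by rewrite modn_small in e; lia.
  have : ((t + t') %% M = t + t' - M)%N.
    by rewrite -{1}(subnK h) modnDr modn_small //; lia.
  lia.
rewrite (modn_small (_ : t.+1 < M)%N); last by lia.
have [h|h] := ltnP (t + t') M.
  by rewrite modn_small in e => //; congr (if _ then _ else _); lia.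
have e' : ((t + t') %% M = t + t' - M)%N.
  by rewrite -{1}(subnK h) modnDr modn_small //; lia.
by rewrite {}e' in e; congr (if _ then _ else _); lia.
Qed.

Lemma run0 : run 0 = m.+1.
Proof. by rewrite /run muln0 mod0n. Qed.

Lemma run1 : run 1 = m.
Proof. by rewrite /run muln1 modn_small // u_gt0 leqnn. Qed.

Lemma run_shift_in j : (0 < j < M.*2)%N -> ((run (j + s))%:R : R) =
  (run j)%:R + ((j == 1%N) || (j == M.+1))%:R - (j == M)%:R.
Proof.
move=> /andP[j0 jM]; rewrite run_shift mod0n (modn_small M2).
have [jM'|jM'] := ltnP j M.
  rewrite modn_small // !(gtn_eqF j0) (ltn_eqF jM') (ltn_eqF (_ : j < M.+1)%N) ?orbF //.
  exact: leqW.
have -> : (j %% M = j - M)%N.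
  by rewrite -{1}(subnK jM') modnDr modn_small //; lia.
by congr (_ + _%:R - _%:R); lia.
Qed.

(** * Corners of the polygon of tile centres *)

(** For antiperiodic [v], half the displacement from corner [j] to the opposite corner [j + M].
    Central symmetry about 0 makes this minus corner [j]. *)
Definition wsum (v : nat -> R) (j : nat) : R :=
  \sum_(i < M) (run (j + i))%:R * v (j + i)%N.

Lemma wsumS v j : (forall i, v (i + M)%N = - v i) ->
  wsum v j.+1 = wsum v j - 2 * (run j)%:R * v j.
Proof.
move=> vM; rewrite /wsum.
case: M M2 vM (runM) => // K _ vM cM.
rewrite big_ord_recr big_ord_recl /= addn0.
rewrite (eq_bigr (fun i : 'I_K => (run (j + bump 0 i))%:R * v (j + bump 0 i)%N)).
  have -> : (j.+1 + K = j + K.+1)%N by lia.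
  by rewrite vM cM; ring.
by move=> i _; rewrite /bump addSnnS.
Qed.

Lemma wsumM v j : (forall i, v (i + M)%N = - v i) -> wsum v (j + M) = - wsum v j.
Proof.
move=> vM; rewrite /wsum -sumrN; apply: eq_bigr => i _.
by rewrite addnAC runM vM mulrN.
Qed.

Definition wsum_shift v j : R :=
  \sum_(i < M) (run (j + i + s))%:R * v (j + i)%N.

(** The window starting at [j] meets the corrections at [M] and [M + 1] only. Since [v_(M+1) - v_M]
    is the unit vector [1], corner [j + s] will be the image of corner [j] under the upper branch of
    [F]. *)
Lemma wsum_shiftE v j : (1 < j <= M)%N ->
  wsum_shift v j = wsum v j + v M.+1 - v M.
Proof.
move=> /andP[j1 jM].
rewrite -(@sum_pick _ M j M v); last by lia.
rewrite -(@sum_pick _ M j M.+1 v); last by lia.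
rewrite -big_split -sumrB; apply: eq_bigr => i _ /=.
rewrite run_shift_in; last by have := ltn_ord i; lia.
have -> : (j + i == 1)%N = false by lia.
by rewrite /=; ring.
Qed.

(** Here the corrections are at [1] and [M]. Side [1] gains a tile, so corner [1 + s] comes one step
    [2 v_1] (rotated) before the image of corner [1]. *)
Lemma wsum_shift1 v : wsum_shift v 1 = wsum v 1 + v 1 - v M.
Proof.
rewrite -(@sum_pick _ M 1 M v); last by lia.
rewrite -(@sum_pick _ M 1 1 v); last by lia.
rewrite -big_split -sumrB; apply: eq_bigr => i _ /=.
rewrite run_shift_in; last by have := ltn_ord i; lia.
have -> : (1 + i == M.+1)%N = false by have := ltn_ord i; lia.
by rewrite orbF; ring.
Qed.

(* Corner number [j] of the polygon of tile centres is [- (Wx j, Wy j)]. *)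
Definition Wx := wsum vx.
Definition Wy := wsum vy.

Lemma WxS j : Wx j.+1 = Wx j - 2 * (run j)%:R * vx j.
Proof. by apply: wsumS => i; exact: vxM. Qed.

Lemma WyS j : Wy j.+1 = Wy j - 2 * (run j)%:R * vy j.
Proof. by apply: wsumS => i; exact: vyM. Qed.

Lemma WxM j : Wx (j + M) = - Wx j.
Proof. by apply: wsumM => i; exact: vxM. Qed.

Lemma WyM j : Wy (j + M) = - Wy j.
Proof. by apply: wsumM => i; exact: vyM. Qed.

Lemma vxM0 : vx M = - (1 / 2).
Proof. by rewrite -[X in vx X]add0n vxM // vx0. Qed.
Lemma vyM0 : vy M = - a.
Proof. by rewrite -[X in vy X]add0n vyM // vy0. Qed.
Lemma vxM1 : vx M.+1 = 1 / 2.
Proof. by rewrite -add1n vxM // vx1 // opprK. Qed.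
Lemma vyM1 : vy M.+1 = - a.
Proof. by rewrite -add1n vyM // vy1. Qed.

Lemma Wx_rot0 j : Wx (j + s) =
  cos alpha * wsum_shift vx j - sin alpha * wsum_shift vy j.
Proof.
rewrite /Wx /wsum /wsum_shift !mulr_sumr -sumrB; apply: eq_bigr => i _.
by rewrite addnAC vx_rot; ring.
Qed.

Lemma Wy_rot0 j : Wy (j + s) =
  sin alpha * wsum_shift vx j + cos alpha * wsum_shift vy j.
Proof.
rewrite /Wy /wsum /wsum_shift !mulr_sumr -big_split; apply: eq_bigr => i _ /=.
by rewrite addnAC vy_rot; ring.
Qed.

Lemma Wx_rot j : (1 < j <= M)%N ->
  Wx (j + s) = cos alpha * (Wx j + 1) - sin alpha * Wy j.
Proof.
move=> jM; rewrite Wx_rot0 !wsum_shiftE // -/Wx -/Wy vxM1 vxM0 vyM1 vyM0.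
by field.
Qed.

Lemma Wy_rot j : (1 < j <= M)%N ->
  Wy (j + s) = sin alpha * (Wx j + 1) + cos alpha * Wy j.
Proof.
move=> jM; rewrite Wy_rot0 !wsum_shiftE // -/Wx -/Wy vxM1 vxM0 vyM1 vyM0.
by field.
Qed.

Lemma Wx_rot1 : Wx (1 + s) = cos alpha * Wx 1 - sin alpha * (Wy 1 + 2 * a).
Proof.
rewrite Wx_rot0 !wsum_shift1 -/Wx -/Wy vx1 // vxM0 vy1 // vyM0.
by field.
Qed.

Lemma Wy_rot1 : Wy (1 + s) = sin alpha * Wx 1 + cos alpha * (Wy 1 + 2 * a).
Proof.
rewrite Wy_rot0 !wsum_shift1 -/Wx -/Wy vx1 // vxM0 vy1 // vyM0.
by field.
Qed.

(** Reversing the order of summation and reflecting both runs and vertices gives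
    [Wy 1 = - (Wy 1 + 2 a)]. Thus the tile at corner [1] rests on the real axis. *)
Lemma Wy1 : Wy 1 = - a.
Proof.
have : Wy 1 = - wsum_shift vy 1.
  rewrite /Wy /wsum /wsum_shift (reindex_inj rev_ord_inj) /= -sumrN.
  apply: eq_bigr => i _; have iM := ltn_ord i.
  have -> : (1 + (M - i.+1) = M.+1 - (1 + i))%N by lia.
  rewrite run_reflect ?vy_reflect ?mulrN //.
rewrite wsum_shift1 -/Wy vy1 // vyM0; lra.
Qed.

(** * Supporting lines of the polygon of centres *)

Definition bound j : R := vx j * Wy j - vy j * Wx j.

Lemma boundM j : bound (j + M) = bound j.
Proof. by rewrite /bound WxM WyM vxM // vyM //; ring. Qed.

Lemma boundE j : bound j = \sum_(i < M) (run (j + i))%:R * vcross R M j (j + i).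
Proof.
rewrite /bound /Wx /Wy /wsum !mulr_sumr -sumrB; apply: eq_bigr => i _.
by rewrite /vcross; ring.
Qed.

(** All cross products in [boundE] are nonnegative, and the one of consecutive vertices alone
    suffices. *)
Lemma bound_ge j : m%:R * a <= bound j.
Proof.
rewrite boundE (bigD1 (Ordinal M2)) //= addn1 vcrossS // ler_wpDr //.
  apply: sumr_ge0 => i _; rewrite mulr_ge0 // vcross_ge0 //; exact/ltnW.
rewrite ler_wpM2r ?(ltW (apothem_gt0 _ _)) // ler_nat /run.
by case: ifP.
Qed.

Lemma bound_shift j : (0 < j <= M)%N -> bound (j + s) = bound j - vy j.
Proof.
move=> /andP[j0 jM].
have cs := cos2Dsin2 alpha.
have e x y x' y' : (cos alpha * x - sin alpha * y) * (sin alpha * x' + cos alpha * y')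
   - (sin alpha * x + cos alpha * y) * (cos alpha * x' - sin alpha * y') =
   x * y' - y * x'.
  by rewrite -[RHS]mul1r -[X in _ = X * _]cs; ring.
rewrite /bound vx_rot vy_rot.
have [->|j1] := eqVneq j 1%N.
  by rewrite Wx_rot1 Wy_rot1 e vx1 // vy1 //; field.
by rewrite Wx_rot ?Wy_rot ?e; [ring|lia..].
Qed.

Lemma run_M : run M = m.+1.
Proof. by rewrite -[X in run X]add0n runM run0. Qed.
Lemma WxMS : Wx M.+1 = - Wx 1.
Proof. by rewrite -add1n WxM. Qed.
Lemma WyMS : Wy M.+1 = - Wy 1.
Proof. by rewrite -add1n WyM. Qed.

(* The polygon of tile centres, as an intersection of strips. *)
Definition core (x y : R) : Prop := forall j, `|vx j * y - vy j * x| <= bound j.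

Definition centre (x y : R) : Prop := exists j t : nat,
  [/\ (t <= run j)%N, x = - Wx j + 2 * t%:R * vx j & y = - Wy j + 2 * t%:R * vy j].

Definition island (x y : R) : Prop :=
  core x y \/ exists x0 y0, centre x0 y0 /\ tile M (x - x0) (y - y0).

Definition rotx (x y : R) := cos alpha * x - sin alpha * y.
Definition roty (x y : R) := sin alpha * x + cos alpha * y.

Lemma centreN x y : centre x y -> centre (- x) (- y).
Proof.
move=> [j [t [tn -> ->]]]; exists (j + M)%N, t.
by rewrite runM WxM WyM vxM // vyM //; split=> //; ring.
Qed.

Lemma coreN x y : core x y -> core (- x) (- y).
Proof. by move=> h j; rewrite !mulrN -opprD normrN. Qed.

Lemma islandN x y : island x y -> island (- x) (- y).
Proof.
move=> [h|[x0 [y0 [c0 t0]]]]; first by left; exact: coreN.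
right; exists (- x0), (- y0); split; first exact: centreN.
by have := tileN t0; rewrite !opprB !opprK ![- _ + _]addrC.
Qed.

(* A centre in the upper half plane; the last vertex of the run [j = M] is
   already in the lower one. *)
Definition upper_centre (x y : R) : Prop := exists j t : nat,
  [/\ (0 < j <= M)%N, (t <= run j)%N, (j == M) ==> (t < run j)%N,
      x = - Wx j + 2 * t%:R * vx j & y = - Wy j + 2 * t%:R * vy j].

(** Only the last centre of side [M] needs care: it is minus corner [1]. *)
Lemma centre_upper x y : centre x y -> upper_centre x y \/ upper_centre (- x) (- y).
Proof.
move=> [j [t [tn -> ->]]].
move: j t tn; apply: (@nat_period_ind M); first exact: ltnW.
  move=> j jM t tn.
  case: (altP (j =P M)) => [jM'|jM']; last first.
    by left; exists j, t; split=> //; rewrite (negbTE jM').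
  have [tc|tc] := ltnP t (run j).
    by left; exists j, t; split=> //; rewrite tc implybT.
  right; exists 1%N, 0%N; split=> //; [|by rewrite (ltn_eqF M2)| |].
  - exact: ltnW.
  - have -> : t = run j by apply/eqP; rewrite eqn_leq tn tc.
    by have := WxMS; rewrite WxS jM' => h; rewrite -[Wx 1]opprK -h; ring.
  - have -> : t = run j by apply/eqP; rewrite eqn_leq tn tc.
    by have := WyMS; rewrite WyS jM' => h; rewrite -[Wy 1]opprK -h; ring.
move=> j; split=> h t.
  rewrite runM => /h; rewrite WxM WyM vxM // vyM //.
  rewrite !mulrN !opprD !opprK !(addrC (- _)); tauto.
rewrite -(runM j) => /h; rewrite WxM WyM vxM // vyM //.
rewrite !mulrN !opprD !opprK; tauto.
Qed.

Lemma Wy_step_ge i : vy i >= 0 -> - Wy i <= - Wy i.+1.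
Proof.
move=> h; rewrite WyS; have : 0 <= 2 * (run i)%:R * vy i by rewrite mulr_ge0.
lra.
Qed.

Lemma Wy_step_le i : vy i <= 0 -> - Wy i.+1 <= - Wy i.
Proof.
move=> h; rewrite WyS; have : 2 * (run i)%:R * vy i <= 0 by rewrite mulr_ge0_le0.
lra.
Qed.

Lemma WyM0_ge : a <= - Wy M.
Proof.
have := WyS M; rewrite WyMS Wy1 vyM0 run_M.
have := apothem_gt0 R M2 => a0.
have : 0 <= m%:R * a by rewrite mulr_ge0 // ltW.
rewrite -natr1; lra.
Qed.

(** The heights of the corners [1..M] first rise and then fall, so the minimum is attained at one of
    the two ends. *)
Lemma Wy_ge j : (0 < j <= M)%N -> a <= - Wy j.
Proof.
case: j => // j /= jM.
have [vj|vj] := leP 0 (vy j).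
  have : forall i, (i <= j)%N -> a <= - Wy i.+1.
    elim=> [|i IH] ij; first by rewrite Wy1 opprK.
    apply: le_trans (IH (ltnW ij)) (Wy_step_ge _).
    apply: le_trans vj _; apply: vy_decr => //; lia.
  exact.
have : forall i, (i <= M - j.+1)%N -> a <= - Wy (M - i).
  elim=> [|i IH] ij; first by rewrite subn0 WyM0_ge.
  apply: le_trans (IH (ltnW ij)) _.
  have -> : (M - i = (M - i.+1).+1)%N by lia.
  apply: Wy_step_le.
  case: (posnP j) vj => [->|j0] vj.
    by move: vj; rewrite vy0 ltNge ltW // apothem_gt0.
  apply: le_trans (ltW vj); apply: vy_decr => //; lia.
by move=> /(_ (M - j.+1)%N (leqnn _)); rewrite subKn.
Qed.

Lemma upper_centre_ge x y : upper_centre x y -> a <= y.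
Proof.
move=> [j [t [jM tn jt _ ->]]].
have h0 := Wy_ge jM.
have a0 := apothem_gt0 R M2.
have tn' : t%:R <= (run j)%:R :> R by rewrite ler_nat.
have t0 : 0 <= t%:R :> R by [].
have [v0|v0] := leP 0 (vy j).
  by have : 0 <= 2 * t%:R * vy j by [rewrite mulr_ge0 // mulr_ge0]; lra.
case: (altP (j =P M)) jt => [jM'|jM'] /= jt.
  (* Side [M] ends at height [- a] and each of its steps descends by [2 a]; the centre before the
     last is at height [a]. *)
  have {}tn' : t%:R + 1 <= (run j)%:R :> R by rewrite natr1 ler_nat.
  move: tn' v0; rewrite jM' => tn' v0.
  by have := WyS M; rewrite WyMS Wy1 vyM0 => h; nra.
(* The centre lies between the corners [j] and [j + 1], both high enough. *)
have := @Wy_ge j.+1; rewrite WyS => /(_ _) h1.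
have {}h1 : a <= - (Wy j - 2 * (run j)%:R * vy j) by apply: h1; lia.
nra.
Qed.

(** Side [j] is carried to side [j + s] with the same numbering, except that on side [1] the
    numbering moves up by one. The shortening of side [M] is harmless as its last centre is not an
    upper one. *)
Lemma upper_centre_step x y : upper_centre x y -> centre (rotx (x - 1) y) (roty (x - 1) y).
Proof.
move=> [j [t [jM tn jt -> ->]]]; rewrite /rotx /roty.
case: (altP (j =P 1%N)) => [j1|j1].
  subst j; exists (1 + s)%N, t.+1.
  rewrite Wx_rot1 Wy_rot1 vx_rot vy_rot vx1 // vy1 //; split.
  - rewrite -(@ler_nat R) run_shift_in; last by lia.
    have : t%:R <= (run 1)%:R :> R by rewrite ler_nat.
    by rewrite eqxx /= (ltn_eqF M2) -natr1 subr0 => h; lra.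
  - by rewrite -natr1; field.
  - by rewrite -natr1; field.
exists (j + s)%N, t.
rewrite Wx_rot ?Wy_rot ?vx_rot ?vy_rot; [|lia..]; split; [|ring..].
rewrite -(@ler_nat R) run_shift_in; last by lia.
have -> : (j == 1%N) || (j == M.+1) = false by lia.
case: (altP (j =P M)) jt => [jM'|jM'] /= jt.
  have : t%:R + 1 <= (run j)%:R :> R by rewrite natr1 ler_nat.
  lra.
by rewrite addr0 subr0 ler_nat.
Qed.

Lemma tile_step x y : tile M x y -> tile M (rotx x y) (roty x y).
Proof. exact: tile_rot. Qed.

(* The centre of the tile resting on the left part of the real axis. *)
Definition left_bead_x := Wx 1 + 2 * vx 0.
Definition left_bead_y := Wy 1 + 2 * vy 0.

Lemma left_bead_centre : centre left_bead_x left_bead_y.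
Proof.
(* Since [run M = m + 1], this is the centre before the last on side [M]. *)
exists M, m; rewrite run_M; split=> //.
- by have := WxM 0; rewrite add0n /left_bead_x WxS vxM0 run0 vx0 // -natr1 => ->; field.
- by have := WyM 0; rewrite add0n /left_bead_y WyS vyM0 run0 vy0 // -natr1 => ->; field.
Qed.

(** The form [v_j x W_i] grows with [i] up to [j], so [W_1] may replace [W_j]; what remains is [a]
    times the cross product of [v_1] and [v_j]. *)
Lemma bound1_le j : (0 < j <= M)%N -> 0 <= vy j -> vy j * bound 1 <= a * bound j.
Proof.
move=> /andP[j0 jM] v0; have a0 := apothem_gt0 R M2.
have h i : (i < j)%N -> vx j * Wy 1 - vy j * Wx 1 <= vx j * Wy i.+1 - vy j * Wx i.+1.
  elim: i => [//|i IH] ij; apply: le_trans (IH (ltnW ij)) _.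
  rewrite (WxS i.+1) (WyS i.+1).
  have : 0 <= vcross R M i.+1 j.
    by rewrite -(subnKC (ltnW ij)) vcross_ge0 //; lia.
  have : 0 <= (run i.+1)%:R :> R by [].
  rewrite /vcross; nra.
have := h j.-1; rewrite prednK // => /(_ (leqnn _)).
have : 0 <= vcross R M 1 j.
  by rewrite -(subnKC j0) vcross_ge0 //; lia.
rewrite /vcross /bound vx1 // vy1 // Wy1; nra.
Qed.

(** Otherwise [0 < y] and the strip of [v_0] confine the point to the triangle spanned by the lower
    edge and the centre of the excluded tile. *)
Lemma core_tile x y : core x y -> 0 < y -> ~ tile M (x - left_bead_x) (y - left_bead_y) ->
  vx 1 * y - vy 1 * x <= bound 1 - 2 * a.
Proof.
move=> K y0 nt.
have := K 0%N; rewrite ler_norml => /andP[_].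
have -> : bound 0 = vx 0 * Wy 1 - vy 0 * Wx 1.
  by rewrite /bound WxS WyS; ring.
rewrite leNgt => h; rewrite leNgt; apply/negP => h'; apply: nt.
have a0 := apothem_gt0 R M2.
move: h h'; rewrite /bound /left_bead_x /left_bead_y vx1 // vy1 // vx0 // vy0 // Wy1 -leNgt => h h'.
by apply: tile_rect => //; rewrite ler_norml; apply/andP; split; nra.
Qed.

(** Translation by [-1] adds [vy j] to the form of [v_j] while [bound_shift] subtracts [vy j] from
    its bound, so a margin of [2 vy j] is required. For [vy j > 0] it follows from the margin for
    [j = 1], because [a v_j x z] is [vy j] times [v_1 x z] minus a nonnegative multiple of [y]. *)
Lemma core_bound x y : core x y -> 0 < y -> ~ tile M (x - left_bead_x) (y - left_bead_y) ->
  forall j, (0 < j <= M)%N -> vx j * y - vy j * x <= bound j - 2 * vy j.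
Proof.
move=> K y0 nt j jM.
have a0 := apothem_gt0 R M2.
have [v0|v0] := leP (vy j) 0.
  by have := K j; rewrite ler_norml => /andP[_]; lra.
have h1 := core_tile K y0 nt.
have h2 := bound1_le jM (ltW v0).
have h3 : 0 <= vx 1 * vy j - vy 1 * vx j.
  by have := @vcross_ge0 R M M2 1 (j - 1); rewrite subnKC /vcross; [apply|]; lia.
move: h1 h3; rewrite vx1 // vy1 // => h1 h3.
rewrite -(ler_pM2l a0).
have h4 : vy j * (- (1 / 2) * y - a * x) <= vy j * (bound 1 - 2 * a).
  by rewrite ler_pM2l.
nra.
Qed.

Lemma core_step x y : core x y -> 0 < y -> ~ tile M (x - left_bead_x) (y - left_bead_y) ->
  core (rotx (x - 1) y) (roty (x - 1) y).
Proof.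
move=> K y0 nt.
have h : forall j,
    `|vx (j + s) * roty (x - 1) y - vy (j + s) * rotx (x - 1) y| <= bound (j + s).
  apply: (@nat_period_ind M); first exact: ltnW.
    move=> j jM; have := core_bound K y0 nt jM; rewrite bound_shift //.
    have := K j; rewrite !ler_norml => /andP[h1 _] h2.
    have -> : vx (j + s) * roty (x - 1) y - vy (j + s) * rotx (x - 1) y =
      vx j * y - vy j * x + vy j.
      transitivity ((cos alpha ^+ 2 + sin alpha ^+ 2) * (vx j * y - vy j * x + vy j)).
        by rewrite vx_rot vy_rot /rotx /roty; ring.
      by rewrite cos2Dsin2 mul1r.
    by apply/andP; split; lra.
  move=> j; rewrite addnAC boundM vxM // vyM // !mulNr -opprD normrN; tauto.
have s0 : (0 < s)%N.
  by case: (s) su => // /esym; rewrite muln0 mod0n modn_small.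
have Mk k j :
    `|vx (j + k * M) * roty (x - 1) y - vy (j + k * M) * rotx (x - 1) y|
      <= bound (j + k * M) ->
    `|vx j * roty (x - 1) y - vy j * rotx (x - 1) y| <= bound j.
  elim: k => [|k IH]; first by rewrite mul0n addn0.
  rewrite mulSn [(M + _)%N]addnC addnA boundM vxM // vyM // !mulNr -opprD normrN; exact: IH.
move=> j; apply: (Mk s).
(* Adding a multiple of [M] first writes every index in the form [j' + s] without truncated
   subtraction. *)
have -> : (j + s * M = j + s * M.-1 + s)%N.
  by rewrite -addnA -mulnSr prednK // ltnW.
exact: h.
Qed.

(** A tile travels with its centre, and tiles with a lower centre contain no point with [0 < y]. A
    core point outside the left bead stays in the core. *)
Lemma island_step x y : island x y -> 0 < y ->
  island (rotx (x - 1) y) (roty (x - 1) y).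
Proof.
have tile_case x0 y0 : centre x0 y0 -> tile M (x - x0) (y - y0) -> 0 < y ->
    island (rotx (x - 1) y) (roty (x - 1) y).
  move=> c0 t0 y0'; right.
  case: (centre_upper c0) => [u0|/upper_centre_ge u0].
    exists (rotx (x0 - 1) y0), (roty (x0 - 1) y0).
    split; first exact: upper_centre_step.
    have := tile_step t0; congr tile; rewrite /rotx /roty; ring.
  by have := tile_y t0; rewrite ler_norml => /andP[_]; lra.
move=> [K|[x0 [y0 [c0 t0]]]] y0'; last exact: tile_case t0 _.
have [t0|nt] := pselect (tile M (x - left_bead_x) (y - left_bead_y)).
  by apply: tile_case t0 _ => //; exact: left_bead_centre.
by left; exact: core_step.
Qed.

Lemma island_stepN x y : island x y -> y < 0 ->
  island (rotx (x + 1) y) (roty (x + 1) y).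
Proof.
move=> /islandN h y0; have := islandN (island_step h _).
rewrite oppr_gt0 => /(_ y0); congr island; rewrite /rotx /roty; ring.
Qed.

Lemma centre_step x y : centre x y ->
  (a <= y /\ centre (rotx (x - 1) y) (roty (x - 1) y)) \/
  (y <= - a /\ centre (rotx (x + 1) y) (roty (x + 1) y)).
Proof.
move=> /centre_upper[h|h]; [left|right].
  by split; [exact: upper_centre_ge h|exact: upper_centre_step].
split; first by rewrite lerNr; exact: upper_centre_ge h.
by have := centreN (upper_centre_step h); congr centre; rewrite /rotx /roty; ring.
Qed.

Lemma centre_high : exists x y, centre x y /\ 2 * m%:R * a <= y.
Proof.
exists (- Wx 2), (- Wy 2); split.
  by exists 2, 0%N; split=> //; rewrite mulr0 mul0r addr0.
rewrite WyS Wy1 run1 vy1 //; have := apothem_gt0 R M2; lra.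
Qed.

Lemma core_ball x y : (`|x| + `|y|) * (2 * sin theta)^-1 <= m%:R * a -> core x y.
Proof.
move=> h j; apply: le_trans (bound_ge j); apply: le_trans h.
apply: le_trans (ler_normB _ _) _; rewrite normrM [X in _ + X]normrM mulrDl addrC.
by apply: lerD; rewrite mulrC ler_wpM2l // ?vx_bound ?vy_bound.
Qed.

Lemma island_bounded : exists B, forall x y, island x y -> `|y| <= B.
Proof.
have a0 := apothem_gt0 R M2.
have nn : 0 <= M%:R * (m.+1%:R * a) by rewrite mulr_ge0 // mulr_ge0 // (ltW a0).
exists (bound 0 + bound 1 + (M%:R * (m.+1%:R * a) + 2 * m.+1%:R * a) + a) => x y.
have runle j : (run j)%:R <= m.+1%:R :> R.
  by rewrite ler_nat /run; case: ifP.
have ma : 0 <= m%:R * a by rewrite mulr_ge0 // ltW.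
have b0 := le_trans ma (bound_ge 0); have b1 := le_trans ma (bound_ge 1).
have ma1 : m.+1%:R * a = m%:R * a + a by rewrite -natr1; ring.
move=> [K|[x0 [y0 [[j [t [tn _ ->]]] /tile_y t0]]]].
  (* The height [y] is the difference of the forms for [v_0] and [v_1]. *)
  have := K 0%N; have := K 1%N; rewrite vx0 // vy0 // vx1 // vy1 //.
  rewrite !ler_norml => /andP[h1 h2] /andP[h3 h4].
  by apply/andP; split; lra.
have h1 : `|Wy j| <= M%:R * (m.+1%:R * a).
  apply: le_trans (ler_norm_sum _ _ _) _.
  rewrite mulr_natl -[X in _ *+ X]card_ord -sumr_const; apply: ler_sum => i _.
  by rewrite normrM ger0_norm // ler_pM // ?vy_le.
have h2 : `|t%:R * vy j| <= m.+1%:R * a.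
  rewrite normrM ger0_norm // ler_pM // ?vy_le //.
  by apply: le_trans (runle j); rewrite ler_nat.
move: t0 h1 h2; rewrite !ler_norml => /andP[h1 h2] /andP[h3 h4] /andP[h5 h6].
by apply/andP; split; lra.
Qed.

End Ring.
(** * Complex coordinates *)

Section ComplexFacts.
Variable R : realType.
Implicit Types (z w : Cplx R) (t : R).
Local Notation C := (Cplx R).
Local Notation Re := (@complex.Re R).
Local Notation Im := (@complex.Im R).

Definition cplx_of t : C := Complex t 0.

Lemma Re_add z w : Re (z + w) = Re z + Re w.
Proof. by case: z; case: w. Qed.
Lemma Im_add z w : Im (z + w) = Im z + Im w.
Proof. by case: z; case: w. Qed.
Lemma Re_sub z w : Re (z - w) = Re z - Re w.
Proof. by case: z; case: w. Qed.
Lemma Im_sub z w : Im (z - w) = Im z - Im w.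
Proof. by case: z; case: w. Qed.
Lemma Re_mul z w : Re (z * w) = Re z * Re w - Im z * Im w.
Proof. by case: z; case: w. Qed.
Lemma Im_mul z w : Im (z * w) = Im z * Re w + Re z * Im w.
Proof. by case: z => a b; case: w => c d /=; rewrite addrC. Qed.
Lemma Im_scale t z : Im (cplx_of t * z) = t * Im z.
Proof. by rewrite Im_mul /= mul0r add0r. Qed.

Lemma cplx_ext z w : Re z = Re w -> Im z = Im w -> z = w.
Proof. by case: z => a b; case: w => c d /= -> ->. Qed.

(** A real-valued modulus, as the norm of [Cplx R] takes its values in [Cplx R]. *)
Definition cmod z : R := Num.sqrt (Re z ^+ 2 + Im z ^+ 2).

Lemma normE z : `|z| = cplx_of (cmod z).
Proof. exact: normc_def. Qed.

Lemma cplx_of_lt t t' : (cplx_of t < cplx_of t') = (t < t').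
Proof. exact: ltcR. Qed.

Lemma cplx_of_le t t' : (cplx_of t <= cplx_of t') = (t <= t').
Proof. exact: lecR. Qed.

Lemma cplx_of_gt0 (e : C) : 0 < e -> e = cplx_of (Re e) /\ 0 < Re e.
Proof. by case: e => a b; rewrite ltcE /= => /andP[/eqP -> h]. Qed.

Lemma cmodM z w : cmod (z * w) = cmod z * cmod w.
Proof.
rewrite /cmod Re_mul Im_mul -sqrtrM ?addr_ge0 ?sqr_ge0 //; congr Num.sqrt; ring.
Qed.

Lemma cmod_ge0 z : 0 <= cmod z.
Proof. exact: sqrtr_ge0. Qed.

Lemma cmodD z w : cmod (z + w) <= cmod z + cmod w.
Proof.
rewrite -cplx_of_le -normE; apply: le_trans (ler_normD _ _) _.
by rewrite !normE /cplx_of lecE /= addr0 eqxx /=.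
Qed.

Lemma cmodB z w : cmod (z - w) = cmod (w - z).
Proof. by rewrite /cmod !Re_sub !Im_sub; congr Num.sqrt; ring. Qed.

Lemma cmod0 : cmod 0 = 0.
Proof. by rewrite /cmod /= expr0n /= addr0 sqrtr0. Qed.

Lemma cmod1 : cmod 1 = 1.
Proof. by rewrite /cmod /= expr0n /= expr1n addr0 sqrtr1. Qed.

Lemma cmod_eq0 z : cmod z = 0 -> z = 0.
Proof. by move=> h; apply/eqP; rewrite -normr_eq0 normE h. Qed.

Lemma Im_le_cmod z : `|Im z| <= cmod z.
Proof. by rewrite -sqrtr_sqr ler_wsqrtr // lerDr sqr_ge0. Qed.

Lemma Re_le_cmod z : `|Re z| <= cmod z.
Proof. by rewrite -sqrtr_sqr ler_wsqrtr // lerDl sqr_ge0. Qed.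

Lemma cmod_le z : cmod z <= `|Re z| + `|Im z|.
Proof.
rewrite -[leRHS]ger0_norm ?addr_ge0 // -sqrtr_sqr ler_wsqrtr //.
rewrite sqrrD !real_normK ?num_real //.
have : 0 <= `|Re z| * `|Im z| by rewrite mulr_ge0.
by lra.
Qed.

Lemma cmod_cplx_of t : cmod (cplx_of t) = `|t|.
Proof. by rewrite /cmod /= expr0n /= addr0 sqrtr_sqr. Qed.

Lemma cmodX z n : cmod (z ^+ n) = cmod z ^+ n.
Proof. by elim: n => [|n IH]; rewrite ?expr0 ?cmod1 // !exprS cmodM IH. Qed.

End ComplexFacts.

(** * Components of the regular set *)

Section Dynamics.
Variables (R : realType) (lam : Cplx R).
Hypothesis lam1 : cmod lam = 1.
Local Notation C := (Cplx R).
Local Notation Re := (@complex.Re R).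
Local Notation Im := (@complex.Im R).
Local Notation F := (Fmap lam).
Local Notation U := (regular_set lam).
Implicit Types (x y z w : C) (t : R) (n m : nat).

Lemma lam_neq0 : lam != 0.
Proof. by apply/eqP => h; have := lam1; rewrite h cmod0; lra. Qed.

Lemma cmod_lamX n : cmod (lam ^+ n) = 1.
Proof. by rewrite cmodX lam1 expr1n. Qed.

Lemma Fmap_inj : injective F.
Proof.
move=> z w /(mulfI lam_neq0); rewrite /Hsgn => h.
have H0 (c : bool) : Im (if c then 1 else -1 : C) = 0 by case: c; rewrite //= oppr0.
have e : Im z = Im w by have := congr1 Im h; rewrite !Im_sub !H0 !subr0.
by move: h; rewrite e => /addIr.
Qed.

Lemma iter_Fmap_inj n : injective (iter n F).
Proof. by elim: n => [|n IH] // z w /= /Fmap_inj /IH. Qed.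

Definition hsign z : R := if 0 <= Im z then 1 else -1.

Lemma FmapE z : F z = lam * (z - cplx_of (hsign z)).
Proof.
rewrite /Fmap /Hsgn /hsign; case: ifP => // _.
by congr (_ * (_ - _)); apply: cplx_ext; rewrite //= oppr0.
Qed.

(** * Itineraries *)

Definition noncrit z := forall n, Im (iter n F z) <> 0.

Definition same_itin z w := forall n, (0 <= Im (iter n F z)) = (0 <= Im (iter n F w)).

Lemma Fmap_agree z w : (0 <= Im z) = (0 <= Im w) -> F w - F z = lam * (w - z).
Proof. by move=> h; rewrite /Fmap /Hsgn h -mulrBr; congr (_ * _); rewrite opprB addrA subrK. Qed.

Lemma iter_agree z w n :
  (forall i, (i < n)%N -> (0 <= Im (iter i F z)) = (0 <= Im (iter i F w))) ->
  iter n F w - iter n F z = lam ^+ n * (w - z).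
Proof.
elim: n => [|n IH] h; first by rewrite expr0 mul1r.
have /= IH' := IH (fun i hi => h i (ltnW hi)).
by rewrite /= exprS -mulrA -IH' Fmap_agree // h.
Qed.

Lemma itin_iter z w n : same_itin z w -> iter n F w = iter n F z + lam ^+ n * (w - z).
Proof. by move=> h; rewrite -(iter_agree (n := n)) ?subrKC. Qed.

Lemma itin_sym z w : same_itin z w -> same_itin w z. Proof. by move=> h n. Qed.
Lemma itin_trans z w y : same_itin z w -> same_itin w y -> same_itin z y.
Proof. by move=> h h' n; rewrite h. Qed.
Lemma itin_shift z w m : same_itin z w -> same_itin (iter m F z) (iter m F w).
Proof. by move=> h n; rewrite -!iterD. Qed.

Definition seg x y t : C := x + cplx_of t * (y - x).

Lemma segB x y t : seg x y t - x = cplx_of t * (y - x).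
Proof. by rewrite /seg [x + _]addrC addrK. Qed.

(* Along a convex set avoiding the critical lines, an itinerary can only change
   where the affine map [iter n F] has a real value. *)
Lemma convex_itin (A : set C) :
  (forall x y t, A x -> A y -> 0 <= t <= 1 -> A (seg x y t)) ->
  (forall x, A x -> noncrit x) -> forall x y, A x -> A y -> same_itin x y.
Proof.
move=> cA nA.
suff H n : forall x y, A x -> A y ->
    (forall i, (i < n)%N -> (0 <= Im (iter i F x)) = (0 <= Im (iter i F y))).
  by move=> x y Ax Ay n; exact: (H n.+1).
elim: n => [//|n IH].
have key x y : A x -> A y -> 0 <= Im (iter n F x) -> 0 <= Im (iter n F y).
  move=> Ax Ay hx; rewrite leNgt; apply/negP => hy.
  set a := Im (iter n F x) in hx *; set b := Im (iter n F y) in hy *.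
  have ab : 0 < a - b by lra.
  have At : A (seg x y (a / (a - b))).
    apply: cA => //; apply/andP; split; first by rewrite divr_ge0 // ltW.
    by rewrite ler_pdivrMr // mul1r; lra.
  apply: (nA _ At n).
  have e1 := iter_agree (IH _ _ Ax At); have e2 := iter_agree (IH _ _ Ax Ay).
  have -> : iter n F (seg x y (a / (a - b))) =
      iter n F x + lam ^+ n * (cplx_of (a / (a - b)) * (y - x)).
    by rewrite -[LHS](subrKC (iter n F x)) e1 segB.
  rewrite mulrCA -e2 Im_add Im_scale Im_sub -/a -/b; field; rewrite gt_eqF //.
move=> x y Ax Ay i; rewrite ltnS leq_eqVlt => /orP[/eqP ->|]; last exact: IH.
by apply/idP/idP; apply: key.
Qed.

(** By induction each iterate is affine on the segment, so its imaginary part is a convex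
    combination of two nonzero reals of the same sign. *)
Lemma itin_seg x y t : noncrit x -> noncrit y -> same_itin x y -> 0 <= t <= 1 ->
  noncrit (seg x y t) /\ same_itin x (seg x y t).
Proof.
move=> nx ny xy /andP[t0 t1].
have key n : iter n F (seg x y t) = iter n F x + lam ^+ n * (seg x y t - x) ->
    Im (iter n F (seg x y t)) <> 0 /\ (0 <= Im (iter n F x)) = (0 <= Im (iter n F (seg x y t))).
  move=> ->; rewrite segB mulrCA.
  have := itin_iter n xy; move/eqP; rewrite -subr_eq addrC => /eqP e.
  have {}e : lam ^+ n * (y - x) = iter n F y - iter n F x by rewrite -e; ring.
  rewrite e Im_add Im_scale Im_sub.
  have := xy n; have := nx n; have := ny n.
  move: (Im (iter n F x)) (Im (iter n F y)) => a b /eqP b0 /eqP a0.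
  have [ha|ha] := leP 0 a => /esym hb.
    have {}hb : 0 < b by rewrite lt_neqAle eq_sym b0.
    have {}ha : 0 < a by rewrite lt_neqAle eq_sym a0.
    have h : 0 < a + t * (b - a) by nra.
    by split; [move=> h'; rewrite h' ltxx in h | rewrite (ltW h)].
  have {}hb : b < 0 by rewrite ltNge hb.
  have h : a + t * (b - a) < 0 by nra.
  split; [move=> h'; rewrite h' ltxx in h | by rewrite [RHS]leNgt h] => //.
have H n : forall i, (i < n)%N -> (0 <= Im (iter i F x)) = (0 <= Im (iter i F (seg x y t))).
  elim: n => [//|n IH] i; rewrite ltnS leq_eqVlt => /orP[/eqP ->|]; last exact: IH.
  by apply: (key _ _).2; rewrite -(iter_agree IH) subrKC.
have s : same_itin x (seg x y t) by move=> n; exact: (H n.+1).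
by split=> // n; apply: (key n _).1; exact: itin_iter.
Qed.

Lemma regularP x : U x <-> exists2 e : R, 0 < e & forall w, cmod (w - x) < e -> noncrit w.
Proof.
split.
  move=> /existsNP[B /not_implyP[/nbhs_ballP[e e0 eB] nB]].
  have [ee re0] := cplx_of_gt0 e0.
  exists (Re e) => // w we n wn; apply: nB; exists w; split; first by exists n.
  by apply: eB; rewrite -ball_normE /= normE ee cplx_of_lt cmodB.
move=> [e e0 he] /(_ (ball x (cplx_of e))) [|w [[n wn]]].
  by apply: nbhsx_ballx; rewrite -[0]/(cplx_of 0) cplx_of_lt.
rewrite -ball_normE /= normE cplx_of_lt cmodB => h; exact: (he w h n).
Qed.

Lemma regular_noncrit x : U x -> noncrit x.
Proof. by move=> /regularP[e e0 h]; apply: h; rewrite subrr cmod0. Qed.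

Lemma ball_convex x e (A := [set w : C | cmod (w - x) < e]) :
  forall y z t, A y -> A z -> 0 <= t <= 1 -> A (seg y z t).
Proof.
move=> y z t; rewrite /A /= => hy hz /andP[t0 t1].
have -> : seg y z t - x = cplx_of (1 - t) * (y - x) + cplx_of t * (z - x).
  have -> : cplx_of (1 - t) = 1 - cplx_of t by apply: cplx_ext; rewrite /= ?oppr0 ?addr0.
  rewrite /seg; ring.
apply: le_lt_trans (cmodD _ _) _; rewrite !cmodM !cmod_cplx_of !ger0_norm //; last by lra.
move: hy hz; move: (cmod _) (cmod _) => p q hp hq.
have [->|t0'] := eqVneq t 0; first by lra.
have : 0 < t by rewrite lt_neqAle eq_sym t0'.
nra.
Qed.

Lemma ball_itin x e w : (forall w, cmod (w - x) < e -> noncrit w) -> cmod (w - x) < e -> same_itin x w.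
Proof.
move=> he hw; apply: (convex_itin (@ball_convex x e)) => //=.
by rewrite subrr cmod0; apply: le_lt_trans hw; exact: cmod_ge0.
Qed.

(** * Cells and connected components *)

Definition cell x : set C := [set y | U y /\ same_itin x y].

Lemma cell_refl x : U x -> cell x x. Proof. by []. Qed.

Lemma cell_eq x y : cell x y -> cell y = cell x.
Proof.
move=> [Uy xy]; apply/seteqP; split=> z [Uz h]; split=> //.
  exact: itin_trans h.
by apply: itin_trans h; exact: itin_sym.
Qed.

Lemma ball_regular x e : (forall w, cmod (w - x) < e -> noncrit w) ->
  forall w, cmod (w - x) < e -> U w.
Proof.
move=> he w hw; apply/regularP; exists (e - cmod (w - x)); first by rewrite subr_gt0.
move=> v hv; apply: he.
have -> : v - x = (v - w) + (w - x) by ring.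
by apply: le_lt_trans (cmodD _ _) _; lra.
Qed.

Lemma cell_ball x : U x -> exists2 e : R, 0 < e & forall w, cmod (w - x) < e -> cell x w.
Proof.
move=> /regularP[e e0 he]; exists e => // w hw; split; first exact: ball_regular he _ _.
exact: ball_itin he _.
Qed.

Lemma cell_open x : open (cell x).
Proof.
rewrite openE => y xy; have [e e0 he] := cell_ball xy.1.
apply/nbhs_ballP; exists (cplx_of e) => /=; first by rewrite -[0]/(cplx_of 0) cplx_of_lt.
move=> w; rewrite -ball_normE /= normE cplx_of_lt cmodB => /he.
by rewrite (cell_eq xy).
Qed.

Lemma cell_convex x y z t : cell x y -> cell x z -> 0 <= t <= 1 -> cell x (seg y z t).
Proof.
move=> xy xz t01; rewrite -(cell_eq xy).
have yz : same_itin y z by apply: itin_trans xz.2; exact: itin_sym xy.2.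
split; last exact: (itin_seg (regular_noncrit xy.1) (regular_noncrit xz.1) yz t01).2.
have [e1 e10 h1] := cell_ball xy.1; have [e2 e20 h2] := cell_ball xz.1.
apply/regularP; exists (Num.min e1 e2); first by rewrite lt_min e10 e20.
move=> w; rewrite lt_min => /andP[hw1 hw2].
set d := w - seg y z t in hw1 hw2.
(* A point near the segment lies on a translate of it whose ends are still in the two balls. *)
have -> : w = seg (y + d) (z + d) t by rewrite /d /seg; ring.
have [Uy sy] : cell y (y + d) by apply: h1; rewrite addrC addKr.
have [Uz sz] : cell z (z + d) by apply: h2; rewrite addrC addKr.
apply: (itin_seg _ _ _ t01).1; [exact: regular_noncrit..|].
by apply: itin_trans sz; apply: itin_trans yz; exact: itin_sym.
Qed.

Lemma seg_continuous x y : continuous (seg x y : R -> C).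
Proof.
move=> t; apply/cvgrPdist_lt => /= e e0; have [ee re0] := cplx_of_gt0 e0.
(* The summand 1 avoids a division by zero when [x = y]. *)
have c1 : 0 < cmod (y - x) + 1 by have := cmod_ge0 (y - x); lra.
near=> t'.
rewrite normE ee cplx_of_lt.
have -> : seg x y t - seg x y t' = cplx_of (t - t') * (y - x).
  have -> : cplx_of (t - t') = cplx_of t - cplx_of t' by apply: cplx_ext; rewrite /= ?oppr0 ?addr0.
  rewrite /seg; ring.
rewrite cmodM cmod_cplx_of.
have c0 := cmod_ge0 (y - x).
have : `|t - t'| < Re e / (cmod (y - x) + 1).
  near: t'; apply: (nbhsx_ballx t (Re e / (cmod (y - x) + 1))).
  exact: divr_gt0.
rewrite ltr_pdivlMr //.
have := normr_ge0 (t - t'); nra.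
Unshelve. all: by end_near.
Qed.

(** Convexity joins a cell to [x] by segments inside [U]. Conversely the cells are open and
    partition [U], so each is relatively clopen and contains the component. *)
Lemma cell_component x : U x -> connected_component U x = cell x.
Proof.
move=> Ux; apply/seteqP; split; last first.
  move=> y xy.
  have h := @connected_component_max _ U (seg x y @` `[0, 1]) x.
  apply: h; last 1 first.
  - by exists 1; rewrite /= ?in_itv /= ?ler01 ?lexx // /seg mul1r subrKC.
  - exists 0; rewrite /= ?in_itv /= ?ler01 ?lexx // /seg.
    by rewrite (_ : cplx_of 0 = 0) // mul0r addr0.
  - move=> _ [t /= t01 <-]; rewrite in_itv /= in t01.
    exact: (cell_convex (cell_refl Ux) xy t01).1.
  - apply: connected_continuous_connected; first exact: segment_connected.
    apply: continuous_subspaceT; exact: seg_continuous.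
have cc := @component_connected _ U x.
have sub := @connected_component_sub _ U x.
have h := cc (connected_component U x `&` cell x).
move=> y xy; suff : connected_component U x `&` cell x = connected_component U x.
  by move=> e; move: xy; rewrite -e => -[].
apply: h.
- by exists x; split; [exact: connected_component_refl|].
- by exists (cell x) => //; exact: cell_open.
exists (~` \bigcup_(z in [set z | U z /\ ~ cell x z]) cell z).
  by apply: open_closedC; apply: bigcup_open => z _; exact: cell_open.
apply/seteqP; split=> z [cz hz]; split; [exact: cz| |exact: cz|].
  move=> [w [Uw nw] wz]; apply: nw; rewrite -(cell_eq hz) (cell_eq wz); exact: cell_refl.
apply: contrapT => nz; apply: hz; exists z; last exact: cell_refl (sub _ cz).
by split; [exact: sub|].
Qed.

Lemma is_componentP V : is_component U V <-> exists2 x, U x & V = cell x.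
Proof. by split=> -[x Ux ->]; exists x => //; rewrite cell_component. Qed.

Lemma regular_step z : U z -> U (F z).
Proof.
move=> /[dup] Uz /cell_ball[e e0 he]; apply/regularP; exists e => // w hw.
(* The preimage of [w] under the affine branch of [F] at [z]; it is as close to [z] as [w] is to
   [F z]. *)
set v := z + lam^-1 * (w - F z).
have hv : cell z v.
  apply: he; rewrite /v addrC addKr cmodM.
  have : cmod lam^-1 = 1.
    have : cmod (lam^-1 * lam) = 1 by rewrite mulVf ?lam_neq0 ?cmod1.
    by rewrite cmodM lam1 mulr1.
  by move=> ->; rewrite mul1r.
have -> : w = F v.
  have := itin_iter 1 hv.2; rewrite /= expr1 /v [_ + _ - z]addrC addKr mulrA mulfV ?lam_neq0 //.
  by rewrite mul1r subrKC.
by move=> n; rewrite -iterSr; exact: regular_noncrit hv.1 _.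
Qed.

Local Opaque regular_set.

Lemma regular_iter n z : U z -> U (iter n F z).
Proof. by move=> Uz; elim: n => [//|n IH]; exact: regular_step. Qed.

Lemma cell_iter n x y : cell x y -> cell (iter n F x) (iter n F y).
Proof. by move=> [Uy xy]; split; [exact: regular_iter|exact: itin_shift]. Qed.

Lemma cell_regular x y : cell x y -> U y. Proof. by case. Qed.

Lemma cell_itin x y : cell x y -> same_itin x y. Proof. by case. Qed.

Local Opaque cell Fmap.

(** * Recurrence of cells *)

Hypothesis bounded_orbit : forall z, U z -> exists B, forall n, cmod (iter n F z) <= B.

Lemma pigeonhole (f : nat -> C) (B e : R) : 0 < e -> (forall n, cmod (f n) <= B) ->
  exists i j, (i < j)%N /\ cmod (f i - f j) < e.
Proof.
move=> e0 hB.
(* Grid cells of side [e / 2] in each coordinate; adding [B] keeps the argument of [truncn]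
   nonnegative. *)
pose g (r : R) := Num.truncn ((r + B) / (e / 2)).
have e2 : 0 < e / 2 by lra.
have gP r r' : - B <= r -> - B <= r' -> g r = g r' -> `|r - r'| < e / 2.
  move=> hr hr' hg.
  have h1 : 0 <= (r + B) / (e / 2) by rewrite divr_ge0 //; lra.
  have h2 : 0 <= (r' + B) / (e / 2) by rewrite divr_ge0 //; lra.
  have := truncn_itv h1; have := truncn_itv h2; rewrite -/(g r) -/(g r') hg.
  rewrite !ler_pdivlMr // !ltr_pdivrMr // -natr1 => /andP[a1 a2] /andP[a3 a4].
  by rewrite ltr_norml; apply/andP; split; nra.
set K := g B.
have gK r : `|r| <= B -> (g r < K.+1)%N.
  rewrite ler_norml ltnS => /andP[h1 h2]; apply: le_truncn.
  by rewrite ler_pM2r ?invr_gt0 //; lra.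
have hRe n : `|Re (f n)| <= B by apply: le_trans (hB n); exact: Re_le_cmod.
have hIm n : `|Im (f n)| <= B by apply: le_trans (hB n); exact: Im_le_cmod.
pose code n : 'I_K.+1 * 'I_K.+1 := (inord (g (Re (f n))), inord (g (Im (f n)))).
pose N := #|{: 'I_K.+1 * 'I_K.+1}|.
have [i [j [ij cij]]] : exists i j : nat, (i < j)%N /\ code i = code j.
  apply: contrapT => nex.
  have inj : injective (fun i : 'I_N.+1 => code i).
    move=> i j hij; apply: val_inj; apply/eqP; apply: contrapT => /negP.
    by rewrite neq_ltn => /orP[h|h]; apply: nex; [exists i, j|exists j, i].
  by have := leq_card _ inj; rewrite card_ord ltnn.
exists i, j; split=> //; apply: le_lt_trans (cmod_le _) _.
have [/(congr1 val) h1 /(congr1 val) h2] := cij.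
rewrite /= !inordK ?gK // in h1 h2.
have lo r : `|r| <= B -> - B <= r by rewrite ler_norml => /andP[].
rewrite Re_sub Im_sub [e]splitr; apply: ltrD; apply: gP => //; exact: lo.
Qed.

(** When [F^j x] is close to [F^i x], it equals [F^i y] for some [y] in the ball around [x], as
    [F^i] is an affine isometry there. Injectivity cancels [F^i]. *)
Lemma recurrent x : U x -> exists2 m, (0 < m)%N & cell x (iter m F x).
Proof.
move=> Ux; have [e e0 he] := cell_ball Ux; have [B hB] := bounded_orbit Ux.
have [i [j [ij hij]]] := pigeonhole e0 hB.
exists (j - i)%N; first by rewrite subn_gt0.
set y := x + (lam ^+ i)^-1 * (iter j F x - iter i F x).
have li0 : lam ^+ i != 0 by rewrite expf_neq0 ?lam_neq0.
have hy : cell x y.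
  apply: he; rewrite /y addrC addKr cmodM.
  have : cmod (lam ^+ i)^-1 = 1.
    have : cmod ((lam ^+ i)^-1 * lam ^+ i) = 1 by rewrite mulVf ?cmod1.
    by rewrite cmodM cmod_lamX mulr1.
  by move=> ->; rewrite mul1r cmodB.
suff -> : iter (j - i) F x = y by [].
apply: (@iter_Fmap_inj i); rewrite -iterD subnKC; last exact: ltnW.
have := itin_iter i (cell_itin hy); rewrite /y [_ + _ - x]addrC addKr mulrA mulfV // mul1r subrKC.
by move=> ->.
Qed.

(** The return map is a translation by [b], and [F^(m N) x = x + N b] stays bounded only for
    [b = 0]. *)
Lemma cell_fixed x m : U x -> lam ^+ m = 1 -> cell x (iter m F x) -> iter m F x = x.
Proof.
move=> Ux lm xm.
set b := iter m F x - x.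
have hN N : iter (m * N) F x = x + b *+ N.
  elim: N => [|N IH]; first by rewrite muln0 mulr0n addr0.
  have := itin_iter (m * N) (cell_itin xm); rewrite -iterD addnC -mulnS => ->.
  by rewrite exprM lm expr1n mul1r IH -/b -addrA -mulrSr.
have [B hB] := bounded_orbit Ux.
apply/eqP; rewrite -subr_eq0 -/b; apply/eqP/cmod_eq0/eqP.
rewrite eq_le cmod_ge0 andbT leNgt; apply/negP => b0.
have hb N : N%:R * cmod b <= B + cmod x.
  have -> : N%:R * cmod b = cmod (b *+ N).
    rewrite -[b in RHS]mul1r -mulrnAl cmodM.
    rewrite (_ : 1 *+ N = cplx_of N%:R) ?cmod_cplx_of ?ger0_norm //.
    by rewrite /cplx_of -[RHS]/(real_complex R N%:R) rmorph_nat.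
  have -> : b *+ N = iter (m * N) F x + (0 - x) by rewrite hN; ring.
  apply: le_trans (cmodD _ _) _; rewrite cmodB subr0.
  by rewrite lerD2r.
have := truncnS_gt ((B + cmod x) / cmod b); rewrite ltr_pdivrMr // => h.
have := hb (Num.truncn ((B + cmod x) / cmod b)).+1; lra.
Qed.

Lemma cell_id x m : U x -> lam ^+ m = 1 -> cell x (iter m F x) ->
  forall y, cell x y -> iter m F y = y.
Proof.
move=> Ux lm xm y xy; rewrite (itin_iter m (cell_itin xy)) lm mul1r cell_fixed //.
by rewrite subrKC.
Qed.

Lemma cell_iter_mul x m k : U x -> cell x (iter m F x) -> cell x (iter (k * m) F x).
Proof.
move=> Ux h; elim: k => [|k IH]; first exact: cell_refl.
rewrite mulSn iterD -(cell_eq h); exact: cell_iter.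
Qed.

Lemma least_positive_ex (P : nat -> Prop) n : (0 < n)%N -> P n -> exists l, least_positive P l.
Proof.
move=> n0 Pn; have ex : exists n, (0 < n)%N && `[< P n >] by exists n; rewrite n0; apply/asboolP.
case: (ex_minnP ex) => l /andP[l0 /asboolP Pl] lmin; exists l; split=> // m m0 Pm.
by apply: lmin; rewrite m0; apply/asboolP.
Qed.

Variable q : nat.
Hypotheses (q0 : (0 < q)%N) (lamq : lam ^+ q = 1) (Imlam : Im lam != 0).

Lemma cell_return x : U x -> exists L, [/\ (0 < L)%N, lam ^+ L = 1 & cell x (iter L F x)].
Proof.
move=> Ux; have [m m0 xm] := recurrent Ux; exists (q * m)%N.
split; [by rewrite muln_gt0 q0|by rewrite exprM lamq expr1n|exact: cell_iter_mul].
Qed.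

(** A return time [L] of [x] allows running on for [j L - j] more steps, which leads from the cell
    of [F^j x] back to that of [x]. *)
Lemma cell_unshift x j n : U x -> cell (iter j F x) (iter n F (iter j F x)) -> cell x (iter n F x).
Proof.
move=> Ux; have [L [L0 _ xL]] := cell_return Ux => h.
have xLj := cell_iter_mul (j) Ux xL.
have := cell_iter (j * L - j) h; rewrite -!iterD.
have e1 : (j * L - j + j = j * L)%N by rewrite subnK // leq_pmulr.
have -> : (j * L - j + n + j = n + j * L)%N by rewrite addnAC e1 addnC.
rewrite e1 iterD (cell_eq xLj) => h'.
by rewrite -(cell_eq h') (cell_eq (cell_iter n xLj)); exact: (cell_refl (regular_iter Ux)).
Qed.

Lemma cell_image x n : U x -> iter n F @` cell x = cell (iter n F x).
Proof.
move=> Ux; have [L [L0 lL xL]] := cell_return Ux.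
have xLn := cell_iter_mul (n) Ux xL.
have e1 : (n * L - n + n = n * L)%N by rewrite subnK // leq_pmulr.
apply/seteqP; split=> [_ [y xy <-]|w xw]; first exact: cell_iter.
(* [F^(n L)] is the identity on the target cell, so this is a preimage of [w]. *)
exists (iter (n * L - n) F w).
  by have := cell_iter (n * L - n) xw; rewrite -iterD e1 (cell_eq xLn).
rewrite -iterD addnC e1.
apply: (@cell_id (iter n F x) (n * L) (regular_iter Ux) _ _ w xw).
  by rewrite mulnC exprM lL expr1n.
by rewrite -iterD addnC iterD; exact: cell_iter.
Qed.

Lemma cell_eqP x y : U y -> cell y = cell x -> cell x y.
Proof. by move=> Uy <-; exact: cell_refl. Qed.

Lemma image_cell_eq x n : U x -> iter n F @` cell x = cell x <-> cell x (iter n F x).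
Proof.
move=> Ux; rewrite (cell_image n Ux); split; last exact: cell_eq.
exact: (cell_eqP (regular_iter Ux)).
Qed.

Lemma cell_period x : U x -> exists l, least_positive (fun n => cell x (iter n F x)) l.
Proof.
by move=> Ux; have [L [L0 _ xL]] := cell_return Ux; exact: least_positive_ex L0 xL.
Qed.

Lemma set_period_cell x l : U x ->
  least_positive (fun n => cell x (iter n F x)) l <-> set_period F (cell x) l.
Proof.
move=> Ux; split=> -[l0 xl lmin]; split; [exact: l0| | |exact: l0| |].
- exact/image_cell_eq.
- by move=> m m0 /(image_cell_eq _ Ux); exact: lmin.
- exact/image_cell_eq.
- by move=> m m0 xm; apply: (lmin m m0); exact/image_cell_eq.
Qed.

Lemma cell_period_dvd x l n : U x -> least_positive (fun n => cell x (iter n F x)) l ->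
  cell x (iter n F x) -> (l %| n)%N.
Proof.
move=> Ux [l0 xl lmin] xn; rewrite /dvdn; apply: contrapT => /negP; rewrite -lt0n => r0.
suff : cell x (iter (n %% l) F x) by move/(lmin _ r0); rewrite leqNgt ltn_mod l0.
have xd := cell_iter_mul (n %/ l) Ux xl.
have h := cell_iter (n %% l) xd; move: h; rewrite -iterD addnC -divn_eq => h.
by apply: cell_eqP; [exact: regular_iter|rewrite -(cell_eq h) (cell_eq xn)].
Qed.

(** * Centers and periodic orbits *)

Lemma cell_average x (f : nat -> C) k : (forall i, cell x (f i)) ->
  cell x ((\sum_(i < k.+1) f i) / k.+1%:R).
Proof.
move=> hf; elim: k => [|k IH]; first by rewrite big_ord1 divr1.
have k1 : 0 < k.+2%:R^-1 :> R by rewrite invr_gt0.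
have k2 : k.+2%:R^-1 <= 1 :> R by rewrite invf_le1 // ler1n.
have := cell_convex IH (hf k.+1) (t := k.+2%:R^-1); rewrite ltW //= k2 => /(_ isT).
suff -> : seg ((\sum_(i < k.+1) f i) / k.+1%:R) (f k.+1) k.+2%:R^-1 =
  (\sum_(i < k.+2) f i) / k.+2%:R by [].
rewrite [in RHS]big_ord_recr /= /seg.
have -> : cplx_of k.+2%:R^-1 = (k.+2%:R)^-1 :> C.
  rewrite -[LHS]/((k.+2%:R^-1)%:C)%C fmorphV rmorph_nat //.
have n1 : k.+1%:R != 0 :> C by rewrite pnatr_eq0.
have n2 : k.+2%:R != 0 :> C by rewrite pnatr_eq0.
move: (\sum_(i < k.+1) f i) (f k.+1) => S v.
move: n1 n2; rewrite -[k.+2%:R]natr1; move: (k.+1%:R : C) => K n1 n2.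
by field; rewrite n1 n2.
Qed.

(** [F^l] is affine on the cell and permutes the cycle [x, F^l x, ...] of length [k], so it fixes
    the average. *)
Lemma cell_center x l k : U x -> cell x (iter l F x) -> (0 < k)%N -> lam ^+ (l * k) = 1 ->
  exists2 c, cell x c & iter l F c = c.
Proof.
move=> Ux xl; case: k => // k _ lk.
pose f i := iter (i * l) F x.
have hf i : cell x (f i) by exact: cell_iter_mul.
exists ((\sum_(i < k.+1) f i) / k.+1%:R); first exact: cell_average.
rewrite (itin_iter l (cell_itin (cell_average k hf))).
have fS i : f i.+1 = iter l F x + lam ^+ l * (f i - x).
  by rewrite /f mulSn iterD; exact: itin_iter (cell_itin (hf i)).
have fk : f k.+1 = f 0%N.
  by apply: (@cell_fixed x (k.+1 * l) Ux _ (hf _)); rewrite mulnC.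
have hS : \sum_(i < k.+1) f i = \sum_(i < k.+1) f i.+1.
  have h1 : \sum_(i < k.+2) f i = f 0%N + \sum_(i < k.+1) f i.+1 by rewrite big_ord_recl.
  have h2 : \sum_(i < k.+2) f i = \sum_(i < k.+1) f i + f k.+1 by rewrite big_ord_recr.
  by apply: (addrI (f 0%N)); rewrite -h1 h2 fk addrC.
have n1 : k.+1%:R != 0 :> C by rewrite pnatr_eq0.
apply: (mulIf n1); rewrite divfK // [RHS]hS.
have -> : \sum_(i < k.+1) f i.+1 = \sum_(i < k.+1) (iter l F x + lam ^+ l * (f i - x)).
  by apply: eq_bigr => i _; exact: fS.
rewrite big_split /= -mulr_sumr sumrB !sumr_const card_ord.
rewrite -[iter l F x *+ _]mulr_natr -[x *+ _]mulr_natr.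
by field.
Qed.

Lemma orbit_drift y n : cmod (iter n F y - lam ^+ n * y) <= n%:R.
Proof.
elim: n => [|n IH]; first by rewrite expr0 mul1r subrr cmod0.
rewrite /= FmapE exprS -mulrA -mulrBr cmodM lam1 mul1r addrAC.
apply: le_trans (cmodD _ _) _; rewrite -natr1 lerD //.
rewrite -[X in cmod X]sub0r cmodB subr0 cmod_cplx_of /hsign.
by case: ifP; rewrite ?normrN normr1.
Qed.

Lemma Re_sum n (f : nat -> C) : Re (\sum_(i < n) f i) = \sum_(i < n) Re (f i).
Proof. by elim: n => [|n IH]; rewrite ?big_ord0 // !big_ord_recr Re_add IH. Qed.
Lemma Im_sum n (f : nat -> C) : Im (\sum_(i < n) f i) = \sum_(i < n) Im (f i).
Proof. by elim: n => [|n IH]; rewrite ?big_ord0 // !big_ord_recr Im_add IH. Qed.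

Lemma drift_sum y n : lam^-1 ^+ n * iter n F y =
  y - \sum_(i < n) lam^-1 ^+ i * cplx_of (hsign (iter i F y)).
Proof.
elim: n => [|n IH]; first by rewrite expr0 mul1r big_ord0 subr0.
rewrite big_ord_recr /= opprD addrA -IH FmapE exprSr -mulrA mulKf ?lam_neq0 //.
by rewrite mulrBr.
Qed.

Lemma unit_inv w : cmod w = 1 -> w^-1 = Complex (Re w) (- Im w).
Proof.
move=> w1; have h : Re w ^+ 2 + Im w ^+ 2 = 1.
  by move: w1 => /(congr1 (fun r => r ^+ 2)); rewrite sqr_sqrtr ?expr1n // addr_ge0 ?sqr_ge0.
have w0 : w != 0 by apply/eqP => e; move: w1; rewrite e cmod0; lra.
apply: (mulfI w0); rewrite mulfV //; apply: cplx_ext; rewrite ?Re_mul ?Im_mul /=; first by rewrite -h; ring.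
by ring.
Qed.

(* The visited half planes cancel out over a period, and each of them
   contributes |Im| up to the displacement of the rotated frame. *)
Lemma periodic_Im_le y L : lam ^+ L = 1 -> iter L F y = y ->
  forall n, (n < L)%N -> `|Im (iter n F y)| <= (L * L)%:R.
Proof.
move=> lL yL.
have s0 : \sum_(i < L) lam^-1 ^+ i * cplx_of (hsign (iter i F y)) = 0.
  have := drift_sum y L; rewrite yL exprVn lL invr1 mul1r => h.
  by apply/eqP; rewrite -oppr_eq0; apply/eqP/(addrI y); rewrite -h addr0.
have hz : \sum_(i < L) hsign (iter i F y) * Im (lam ^+ i * y) = 0.
  pose g i := lam^-1 ^+ i * cplx_of (hsign (iter i F y)).
  have := congr1 Re s0; have := congr1 Im s0.
  rewrite (Re_sum _ g) (Im_sum _ g) => h1 h2.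
  (* As [lam] has modulus 1, [Im (lam^i y)] is [Im y Re (lam^-i) - Re y Im (lam^-i)], so the sum
     reduces to both parts of [s0]. *)
  have -> : \sum_(i < L) hsign (iter i F y) * Im (lam ^+ i * y) =
    Im y * (\sum_(i < L) Re (lam^-1 ^+ i * cplx_of (hsign (iter i F y)))) -
    Re y * (\sum_(i < L) Im (lam^-1 ^+ i * cplx_of (hsign (iter i F y)))).
    rewrite !mulr_sumr -sumrB; apply: eq_bigr => i _.
    rewrite exprVn (unit_inv (cmod_lamX i)) Im_mul Re_mul [in RHS]Im_mul /=; ring.
  by rewrite h1 h2; ring.
have hs n : `|Im (iter n F y)| = hsign (iter n F y) * Im (iter n F y).
  rewrite /hsign; case: ifP => h; first by rewrite mul1r ger0_norm.
  by rewrite mulN1r ler0_norm // ltW // ltNge h.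
have total : \sum_(i < L) `|Im (iter i F y)| <= (L * L)%:R.
  (* Subtracting the vanishing sum [hz] leaves only drifts, each below [L] by [orbit_drift]. *)
  have -> : \sum_(i < L) `|Im (iter i F y)| =
    \sum_(i < L) hsign (iter i F y) * Im (iter i F y - lam ^+ i * y).
    transitivity (\sum_(i < L) hsign (iter i F y) * Im (iter i F y) -
                  \sum_(i < L) hsign (iter i F y) * Im (lam ^+ i * y)).
      by rewrite hz subr0; apply: eq_bigr => i _; exact: hs.
    by rewrite -sumrB; apply: eq_bigr => i _; rewrite Im_sub mulrBr.
  rewrite natrM mulr_natr -[X in _ *+ X]card_ord -sumr_const.
  apply: ler_sum => i _; apply: le_trans (ler_norm _) _; rewrite normrM.
  have -> : `|hsign (iter i F y)| = 1.
    by rewrite /hsign; case: ifP; rewrite ?normrN normr1.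
  rewrite mul1r; apply: le_trans (Im_le_cmod _) _; apply: le_trans (orbit_drift _ _) _.
  by rewrite ler_nat ltnW.
move=> n nL; apply: le_trans total.
by rewrite (bigD1 (Ordinal nL)) //= lerDl sumr_ge0.
Qed.

(** For nonreal [lam], the height of [F z] involves [Re z] with the nonzero coefficient [Im lam];
    two consecutive heights thus control the point. *)
Lemma Re_bound z : `|Re z| <= (`|Im (F z)| + `|Im z|) / `|Im lam| + 1.
Proof.
have a0 : 0 < `|Im lam| by rewrite normr_gt0.
have h : Im lam * Re z = Im (F z) - Re lam * Im z + Im lam * hsign z.
  by rewrite FmapE Im_mul Re_sub Im_sub /= subr0; ring.
rewrite -[1](@mulfV _ `|Im lam|) ?gt_eqF // -mulrDl ler_pdivlMr // mulrC -normrM h.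
apply: le_trans (ler_normD _ _) _; apply: lerD.
  apply: le_trans (ler_normB _ _) _; rewrite lerD2l normrM ler_piMl //.
  by rewrite -lam1 Re_le_cmod.
rewrite normrM ler_piMr // /hsign.
by case: ifP; rewrite ?normrN normr1.
Qed.

Lemma cell_bounded x : U x -> bounded_set (cell x).
Proof.
move=> Ux; have [m m0 xm] := recurrent Ux.
(* The factor 2 forces [1 < L], so that [periodic_Im_le] also covers the iterate of index 1. *)
set L := (2 * q * m)%N.
have L1 : (1 < L)%N by rewrite /L; lia.
have lL : lam ^+ L = 1 by rewrite /L -mulnA mulnCA exprM lamq expr1n.
have xL : cell x (iter L F x) by exact: cell_iter_mul.
pose B : R := ((L * L)%:R + (L * L)%:R) / `|Im lam| + 1 + (L * L)%:R.
exists (cplx_of B); split; first by rewrite /= -[cplx_of B]/(B%:C)%C complex_real.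
move=> M hM y xy /=; apply: le_trans (ltW hM); rewrite normE cplx_of_le.
have yL := cell_id Ux lL xL xy.
have h0 := periodic_Im_le lL yL (ltnW L1); have h1 := periodic_Im_le lL yL L1.
apply: le_trans (cmod_le _) _; apply: lerD => //.
apply: le_trans (Re_bound _) _; rewrite lerD2r ler_pM2r ?invr_gt0 ?normr_gt0 //.
exact: lerD.
Qed.

Lemma component_structure V : is_component U V ->
  exists l k : nat,
      [/\ (0 < l)%N /\ (0 < k)%N,
          set_period F V l,
          forall j, (j < l)%N -> is_component U (iter j F @` V),
          forall i j, (i < l)%N -> (j < l)%N ->
            iter i F @` V = iter j F @` V -> i = j
        & forall j, (j < l)%N ->
            let W := iter j F @` V in
            iter l F @` W = W /\
            exists (c : C) (r : C -> C),
              [/\ W c, rotation_about c r, map_order r k,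
                  forall z, W z -> iter l F z = r z
                & point_period F c l /\
                  forall z, W z -> z <> c -> point_period F z (k * l)]].
Proof.
move=> /is_componentP[x Ux ->]; have [l hl] := cell_period Ux.
have [l0 xl lmin] := hl.
(* The order of the rotation is the multiplicative order of [lam ^+ l]. *)
have [k [k0 lk kmin]] : exists k, least_positive (fun k => (lam ^+ l) ^+ k = 1) k.
  by apply: (least_positive_ex q0); rewrite -exprM mulnC exprM lamq expr1n.
exists l, k; split.
- by split.
- exact/set_period_cell.
- move=> j _; rewrite (cell_image j Ux); apply/is_componentP.
  by exists (iter j F x); [exact: regular_iter|].
- have inj i j : (i < j)%N -> (j < l)%N -> iter i F @` cell x = iter j F @` cell x -> False.
    move=> ij jl; rewrite (cell_image i Ux) (cell_image j Ux) => h.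
    have : cell (iter i F x) (iter (j - i) F (iter i F x)).
      by rewrite -iterD (subnK (ltnW ij)) h; exact: (cell_refl (regular_iter Ux)).
    move/(cell_unshift Ux)/lmin; rewrite subn_gt0 => /(_ ij); lia.
  move=> i j il jl h; case: (ltngtP i j) => // ij; [case: (inj i j ij jl h)|].
  by case: (inj j i ij il (esym h)).
move=> j jl W; rewrite /W {W} (cell_image j Ux).
set y := iter j F x; have Uy : U y by exact: regular_iter.
have yl : cell y (iter l F y).
  by rewrite /y -iterD addnC iterD; exact: cell_iter.
split; first exact/image_cell_eq.
have lk' : lam ^+ (l * k) = 1 by rewrite exprM.
have [c yc cl] := cell_center Uy yl k0 lk'.
have Uc := cell_regular yc.
have per z n : cell y z -> iter n F z = z -> (l %| n)%N.
  move=> yz zn; have := cell_iter n yz; rewrite zn => /cell_eq e.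
  apply: (cell_period_dvd Ux hl); apply: (@cell_unshift x j n Ux).
  apply: cell_eqP; first exact: (regular_iter Uy).
  by rewrite -e; exact: (cell_eq yz).
have iterr (w : C) m z : iter m (fun z => c + w * (z - c)) z = c + w ^+ m * (z - c).
  elim: m => [|m IH]; first by rewrite expr0 mul1r subrKC.
  by rewrite /= IH exprS -mulrA [c + w ^+ m * _]addrC addrK.
have Fr z : cell y z -> iter l F z = c + lam ^+ l * (z - c).
  move=> yz; rewrite -{1}cl; apply: itin_iter; apply: itin_trans (cell_itin yz); exact: itin_sym (cell_itin yc).
have Frm z m : cell y z -> iter (l * m) F z = c + (lam ^+ l) ^+ m * (z - c).
  move=> yz; rewrite -exprM.
  have cm : iter (l * m) F c = c.
    by elim: m => [|m IH]; rewrite ?muln0 // mulnS iterD IH.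
  rewrite -{1}cm; apply: itin_iter; apply: itin_trans (cell_itin yz); exact: itin_sym (cell_itin yc).
exists c, (fun z => c + lam ^+ l * (z - c)); split=> //.
- by exists (lam ^+ l) => //; rewrite normE cmod_lamX.
- split=> // [z|m m0 h]; first by rewrite iterr lk mul1r subrKC.
  (* Evaluation at [c + 1] recovers the multiplier of the iterated rotation. *)
  apply: kmin => //; have := h (c + 1); rewrite iterr [c + 1]addrC addrK mulr1 addrC.
  by move/addrI.
split.
  by split=> // m m0 cm; apply: dvdn_leq => //; exact: per cm.
move=> z yz zc; split; first by rewrite muln_gt0 k0 l0.
  by rewrite mulnC Frm // lk mul1r subrKC.
(* A period is a multiple [d l]; off the center this forces [(lam ^+ l) ^+ d = 1], hence
   [k <= d]. *)
move=> m m0 zm; have /dvdnP[d dm] := per _ _ yz zm.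
rewrite dm leq_mul2r; apply/orP; right; apply: kmin.
  by move: m0; rewrite dm muln_gt0 => /andP[].
move: zm; rewrite dm mulnC Frm // => h.
have zc0 : z - c != 0 by rewrite subr_eq0; apply/eqP.
apply: (mulIf zc0); rewrite mul1r; apply: (addrI c); rewrite h subrKC //.
Qed.

(** A component of period [l <= N] is fixed pointwise by [F^(q l)], so its heights are at most
    [(N q)^2]. *)
Lemma unbounded_periods : (forall B, exists2 z, U z & B <= Im z) ->
  forall N : nat, exists (V : set C) (l : nat),
    [/\ is_component U V, set_period F V l & (N < l)%N].
Proof.
move=> high N; have [z Uz hz] := high (((N * q) * (N * q)).+1)%:R.
have [l hl] := cell_period Uz; exists (cell z), l; split.
- by apply/is_componentP; exists z.
- exact/set_period_cell.
have [l0 zl _] := hl; rewrite ltnNge; apply/negP => lN.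
have lL : lam ^+ (q * l) = 1 by rewrite exprM lamq expr1n.
have zL := cell_fixed Uz lL (cell_iter_mul q Uz zl).
have := periodic_Im_le lL zL (n := 0); rewrite muln_gt0 q0 l0 => /(_ isT) /=.
move=> h; have := le_trans hz (le_trans (ler_norm _) h); rewrite ler_nat leqNgt ltnS.
by rewrite leq_mul // mulnC leq_mul2r lN orbT.
Qed.

End Dynamics.

(** * Rational rotations *)

Lemma expi_add (R : realType) (a b : R) : expi (a + b) = expi a * expi b.
Proof. by apply: cplx_ext; rewrite ?Re_mul ?Im_mul /= ?cosD ?sinD //; ring. Qed.

Lemma expi_mul_nat (R : realType) (a : R) n : expi (a * n%:R) = expi a ^+ n.
Proof.
elim: n => [|n IH]; first by rewrite mulr0 expr0; apply: cplx_ext; rewrite /= ?cos0 ?sin0.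
by rewrite -natr1 mulrDr mulr1 expi_add IH exprSr.
Qed.

Lemma cmod_expi (R : realType) (a : R) : cmod (expi a) = 1.
Proof. by rewrite /cmod /= cos2Dsin2 sqrtr1. Qed.

Lemma expi_2pi (R : realType) : expi (2 * pi : R) = 1.
Proof.
have -> : 2 * pi = 0 + pi *+ 2 :> R by rewrite add0r -[RHS]mulr_natl.
by apply: cplx_ext; rewrite /= ?cosD2pi ?sinD2pi ?cos0 ?sin0.
Qed.

Lemma coprime_inverse (s M : nat) : (1 < M)%N -> coprime s M ->
  exists2 u, (u < M)%N & (u * s = 1 %[mod M])%N.
Proof.
move=> M1 /eqP g; have s0 : (0 < s)%N.
  by rewrite lt0n; apply/eqP => e; move: g M1; rewrite e gcd0n => ->.
have [k1 k2 e _] := egcdnP M s0.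
exists (k1 %% M)%N; first by rewrite ltn_mod ltnW.
by rewrite modnMml e g modnMDl.
Qed.

(** For odd [q] take [M = q] and [s = 2 p]; for even [q], [M = q / 2] and [s = p]. The last equation
    says that [lam] turns the polygon by [s] vertices. *)
Lemma ring_parameters (p q : nat) : (2 < q)%N -> coprime p q ->
  exists M s u, [/\ (1 < M)%N, (u < M)%N, (u * s = 1 %[mod M])%N & (s * q = 2 * p * M)%N].
Proof.
move=> q2 pq; have [M [s [M1 sM e]]] :
    exists M s, [/\ (1 < M)%N, coprime s M & (s * q = 2 * p * M)%N].
  have [qo|qe] := boolP (odd q).
    exists q, (2 * p)%N; split=> //; first exact: ltnW.
    by rewrite coprimeMl pq coprime2n qo.
  have e := even_halfK qe; exists q./2, p.
  have eq : q = (2 * q./2)%N by lia.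
  split; [by lia| |by rewrite {1}eq; lia].
  by apply: coprime_dvdr pq; rewrite [X in (_ %| X)%N]eq dvdn_mull.
by have [u uM us] := coprime_inverse M1 sM; exists M, s, u.
Qed.

Section Rational.
Variables (R : realType) (M s u : nat).
Hypotheses (M2 : (1 < M)%N) (uM : (u < M)%N) (su : (u * s = 1 %[mod M])%N).
Local Notation C := (Cplx R).
Local Notation Re := (@complex.Re R).
Local Notation Im := (@complex.Im R).
Local Notation a := (apothem R M).
Local Notation lam := (expi (2 * s%:R * theta R M)).
Local Notation F := (Fmap lam).
Local Notation U := (regular_set lam).

(** The angle is [s pi / M] with [s] not a multiple of [M], so [lam] is not real. For real [lam] of
    modulus 1 the two open half planes would be unbounded components. *)
Lemma sin_angle_neq0 : sin (2 * s%:R * theta R M) != 0.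
Proof.
have M0 : (0 < M)%N by exact: ltnW.
have M0' : M%:R != 0 :> R by rewrite pnatr_eq0 -lt0n.
have shift x d : `|sin (x + d%:R * pi)| = `|sin x| :> R.
  elim: d => [|d IH]; first by rewrite mul0r addr0.
  by rewrite -natr1 mulrDl mul1r addrA sinDpi normrN.
have e : 2 * s%:R * theta R M = 2 * (s %% M)%:R * theta R M + (s %/ M)%:R * pi.
  by rewrite {1}(divn_eq s M) natrD natrM -(thetaM R M2); ring.
rewrite -normr_eq0 e shift normr_eq0 gt_eqF //; apply: sin_gt0_pi.
have r0 : 1 <= (s %% M)%:R :> R.
  rewrite ler1n lt0n; apply/eqP => r0; move: su.
  by rewrite -modnMmr r0 muln0 mod0n modn_small.
have rM : (s %% M)%:R + 1 <= M%:R :> R by rewrite natr1 ler_nat ltn_mod.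
have t0 := theta_gt0 R M2; rewrite -(thetaM R M2); apply/andP; split; nra.
Qed.

Lemma Fmap_coord (z : C) (h : R) : Hsgn z = cplx_of h ->
  Re (F z) = rotx M s (Re z - h) (Im z) /\ Im (F z) = roty M s (Re z - h) (Im z).
Proof. by rewrite /Fmap => ->; rewrite Re_mul Im_mul Re_sub Im_sub /= subr0 /rotx /roty; split; ring. Qed.

Lemma Hsgn_ge (z : C) : 0 <= Im z -> Hsgn z = cplx_of 1.
Proof. by rewrite /Hsgn => ->. Qed.

Lemma Hsgn_lt (z : C) : Im z < 0 -> Hsgn z = cplx_of (-1).
Proof. by rewrite ltNge /Hsgn => /negbTE ->; apply: cplx_ext; rewrite //= oppr0. Qed.

Lemma orbit_island m (z : C) : noncrit lam z -> island M u m (Re z) (Im z) ->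
  forall n, island M u m (Re (iter n F z)) (Im (iter n F z)).
Proof.
move=> nz iz; elim=> [//|n IH] /=; have := nz n.
set w := iter n F z in IH *; have [w0|w0|w0] := ltgtP 0 (Im w) => //.
- by have [-> ->] := Fmap_coord (Hsgn_ge (ltW w0)) => _; apply: island_step.
- by have [-> ->] := Fmap_coord (Hsgn_lt w0) => _; rewrite opprK; apply: island_stepN.
- by move=> /(_ (esym w0)).
Qed.

Lemma Im_orbit_bounded (z : C) : noncrit lam z -> exists B, forall n, `|Im (iter n F z)| <= B.
Proof.
move=> nz.
set X := (`|Re z| + `|Im z|) * (2 * sin (theta R M))^-1.
have a0 := apothem_gt0 R M2.
(* Large enough for the core of the necklace with parameter [m] to contain [z]. *)
pose m := (Num.truncn (X / a)).+1.
have hm : X <= m%:R * a by rewrite -ler_pdivrMr // ltW // truncnS_gt.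
have [B hB] := island_bounded R u m M2.
exists B => n; apply: hB; apply: (orbit_island nz); left; exact: (core_ball u M2 hm).
Qed.

Lemma orbit_bounded (z : C) : U z -> exists B, forall n, cmod (iter n F z) <= B.
Proof.
move=> /regular_noncrit /Im_orbit_bounded[B hB].
exists ((B + B) / `|Im lam| + 1 + B) => n.
apply: le_trans (cmod_le _) _; apply: lerD; last exact: hB.
have := @Re_bound R lam (cmod_expi _) sin_angle_neq0 (iter n F z) => /le_trans; apply.
rewrite lerD2r ler_pM2r ?invr_gt0 ?normr_gt0 ?sin_angle_neq0 //.
by apply: lerD; [exact: (hB n.+1)|].
Qed.

(** The centres on the orbit of [c] stay at distance at least [a] from the real axis, so a disc of
    radius [a] follows the orbit isometrically and never meets the axis. *)
Lemma centre_regular m (c : C) : centre M u m (Re c) (Im c) -> U c.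
Proof.
move=> cc; have a0 := apothem_gt0 R M2; apply/regularP; exists a => // w hw n.
suff [cn wn] : centre M u m (Re (iter n F c)) (Im (iter n F c)) /\
    cmod (iter n F w - iter n F c) < a.
  have := le_lt_trans (Im_le_cmod _) wn; rewrite Im_sub ltr_norml => /andP[h1 h2] h0.
  by have [[h3 _]|[h3 _]] := centre_step M2 uM su cn; lra.
elim: n => [//|n [cn wn]] /=.
have := le_lt_trans (Im_le_cmod _) wn; rewrite Im_sub ltr_norml => /andP[h1 h2].
have [[h3 h4]|[h3 h4]] := centre_step M2 uM su cn.
  have c0 : 0 <= Im (iter n F c) by lra.
  have w0 : 0 <= Im (iter n F w) by lra.
  have [-> ->] := Fmap_coord (Hsgn_ge c0); split=> //.
  by rewrite Fmap_agree ?cmodM ?cmod_expi ?mul1r // c0 w0.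
have c0 : Im (iter n F c) < 0 by lra.
have w0 : Im (iter n F w) < 0 by lra.
have [-> ->] := Fmap_coord (Hsgn_lt c0); rewrite opprK; split=> //.
by rewrite Fmap_agree ?cmodM ?cmod_expi ?mul1r // !leNgt c0 w0.
Qed.

Lemma regular_high (B : R) : exists2 z, U z & B <= Im z.
Proof.
have a0 := apothem_gt0 R M2.
pose m := (Num.truncn (B / (2 * a))).+1.
have hm : B <= 2 * m%:R * a.
  have a2 : 0 < 2 * a by rewrite mulr_gt0.
  rewrite (_ : 2 * m%:R * a = m%:R * (2 * a)); last by ring.
  by rewrite -ler_pdivrMr // ltW // truncnS_gt.
have [x [y [xy hy]]] := centre_high R m M2 uM su.
by exists (Complex x y); [exact: (@centre_regular m)|exact: le_trans hm hy].
Qed.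

End Rational.

Theorem theoremA (R : realType) (p q : nat) (hp : (0 < p)%N) (hq : (2 < q)%N)
    (hpq : coprime p q) :
  let alpha : R := 2 * pi * p%:R / q%:R in
  let lam := expi alpha in
  let F := Fmap lam in
  let U := regular_set lam in
  (forall V : set (Cplx R), is_component U V ->
    [/\ open V, bounded_set V & exists l : nat, set_period F V l])
  /\
  (forall V : set (Cplx R), is_component U V ->
    exists l k : nat,
      [/\ (0 < l)%N /\ (0 < k)%N,
          set_period F V l,
          forall j, (j < l)%N -> is_component U (iter j F @` V),
          forall i j, (i < l)%N -> (j < l)%N ->
            iter i F @` V = iter j F @` V -> i = j
        & forall j, (j < l)%N ->
            let W := iter j F @` V in
            iter l F @` W = W /\
            exists (c : Cplx R) (r : Cplx R -> Cplx R),
              [/\ W c, rotation_about c r, map_order r k,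
                  forall z, W z -> iter l F z = r z
                & point_period F c l /\
                  forall z, W z -> z <> c -> point_period F z (k * l)]])
  /\
  (forall N : nat, exists (V : set (Cplx R)) (l : nat),
    [/\ is_component U V, set_period F V l & (N < l)%N]).
Proof.
move=> alpha lam F U.
have [M [s [u [M2 uM us e]]]] := ring_parameters hq hpq.
have q0 : (0 < q)%N by exact: ltnW (ltnW hq).
have q0' : q%:R != 0 :> R by rewrite pnatr_eq0 -lt0n.
have M0' : M%:R != 0 :> R by rewrite pnatr_eq0 -lt0n ltnW.
(* Passes from [2 pi p / q] to the angle [s pi / M] of the necklace. *)
have alphaE : alpha = 2 * s%:R * theta R M.
  have e' : s%:R * q%:R = 2 * p%:R * M%:R :> R by rewrite -!natrM e.
  rewrite /alpha /theta; apply: (mulIf q0'); rewrite divfK //.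
  apply: (mulIf M0').
  rewrite (_ : 2 * s%:R * (pi / (2 * M%:R)) * q%:R * M%:R = (s%:R * q%:R) * pi); last by field.
  by rewrite e'; ring.
have lam1 : cmod lam = 1 by exact: cmod_expi.
have lamq : lam ^+ q = 1.
  rewrite /lam -expi_mul_nat /alpha divfK // expi_mul_nat expi_2pi; exact: expr1n.
have lamE : lam = expi (2 * s%:R * theta R M) by rewrite /lam alphaE.
have Imlam : complex.Im lam != 0 by rewrite lamE; exact: (sin_angle_neq0 R M2 us).
have bd z : regular_set lam z -> exists B, forall n, cmod (iter n (Fmap lam) z) <= B.
  by rewrite lamE; apply: orbit_bounded M2 uM us _.
have str := component_structure lam1 bd q0 lamq Imlam.
split; last split.
- move=> V cV; have [l [k [_ hl _ _ _]]] := str V cV.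
  have [x Ux e1] := (is_componentP lam V).1 cV.
  rewrite e1 in hl *; split; [exact: cell_open| |by exists l].
  exact: (cell_bounded lam1 bd q0 lamq Imlam Ux).
- exact: str.
- apply: (unbounded_periods lam1 bd q0 lamq) => B.
  by rewrite lamE; apply: regular_high M2 uM us _.
Qed.
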